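(* Let $M\cong\mathbb{Z}^n$ be a lattice, let $P\subset M_{\mathbb{R}}:=M\otimes\mathbb{R}$ be a full-dimensional lattice polytope (vertices in $M$), let $\varphi:M_{\mathbb{R}}\cong\mathbb{R}^n\to\mathbb{C}$ be a homogeneous polynomial, and let $f=\{f_Q\}$ be a weight function, i.e. a family of Laurent polynomials $f_Q(y)\in\mathbb{Z}[y^{\pm1}]$ indexed by the non-empty faces $Q\preceq P$. Then for every $\ell\in\mathbb{Z}$: $$E^\varphi_{P,f}(-\ell,y)=(-y)^{\deg(\varphi)}\cdot E^\varphi_{P,\mathbb{D}(f)}(\ell,1/y),$$ and similarly $$\widetilde{E}^\varphi_{P,f}(-\ell,y)=(-1)^{\deg(\varphi)}\cdot \widetilde{E}^\varphi_{P,\mathbb{D}(f)}(\ell,1/y).$$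
   Context: Faces $Q\preceq P$ are non-empty and include $P$ itself. For $\ell\in\mathbb{Z}_{>0}$ the generalized weighted Ehrhart polynomials are $$\widetilde{E}^\varphi_{P,f}(\ell,y):=\sum_{\emptyset\neq Q\preceq P} f_Q(y)(1+y)^{\dim(Q)}\sum_{m\in \mathrm{Relint}(\ell Q)\cap M}\varphi(m),\qquad E^\varphi_{P,f}(\ell,y):=(1+y)^{\deg(\varphi)}\cdot\widetilde{E}^\varphi_{P,f}(\ell,y),$$ where $\mathrm{Relint}(\ell Q)$ is the relative interior of the face $\ell Q$ of the dilated polytope $\ell P$. As functions of $\ell\in\mathbb{Z}_{>0}$ these are values of (unique) polynomials in $\ell$ with coefficients in $\mathbb{C}[y^{\pm1}]$; their values at arbitrary $\ell\in\mathbb{Z}$ are defined by evaluating these polynomials. The dual weight function $\mathbb{D}(f)=\{\mathbb{D}(f)_Q\}$ is $$\mathbb{D}(f)_Q(y):=\sum_{Q\preceq E\preceq P}(1+y)^{\dim(E)-\dim(Q)}\cdot(-y)^{-\dim(E)}\cdot f_E(1/y).$$ The notation $E^\varphi_{P,g}(\ell,1/y)$ means substituting $1/y$ for $y$ in $E^\varphi_{P,g}(\ell,y)$. *)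

(* Defs.v *)
From HB Require Import structures.
From mathcomp Require Import all_boot all_order all_algebra.
From mathcomp Require Import boolp classical_sets cardinality fsbigop reals.
From mathcomp Require Import complex mpoly.

Set Implicit Arguments.
Unset Strict Implicit.
Unset Printing Implicit Defensive.

Import Order.TTheory GRing.Theory Num.Theory.

Local Open Scope ring_scope.
Local Open Scope classical_set_scope.

(* The lattice is Z^n = 'rV[int]_n, inside R^n = 'rV[R]_n via [lattice_pt].
   Convex bodies and their faces are sets of points of R^n. *)

Definition lattice_pt (R : realType) (n : nat) (m : 'rV[int]_n) : 'rV[R]_n :=
  map_mx intr m.

Definition dot (R : realType) (n : nat) (x c : 'rV[R]_n) : R :=
  \sum_(i < n) x 0 i * c 0 i.

Definition conv_hull (R : realType) (n : nat) (S : set 'rV[R]_n) :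
    set 'rV[R]_n :=
  [set x | exists k (v : 'I_k -> 'rV[R]_n) (a : 'I_k -> R),
    [/\ forall i, S (v i), forall i, 0 <= a i, \sum_i a i = 1
      & x = \sum_i a i *: v i]].

Definition aff_hull (R : realType) (n : nat) (S : set 'rV[R]_n) :
    set 'rV[R]_n :=
  [set x | exists k (v : 'I_k -> 'rV[R]_n) (a : 'I_k -> R),
    [/\ forall i, S (v i), \sum_i a i = 1 & x = \sum_i a i *: v i]].

(* The largest d such that S contains d + 1 affinely independent points
   x0, x0 + row 0 A, ..., x0 + row (d - 1) A. *)
Definition aff_dim (R : realType) (n : nat) (S : set 'rV[R]_n) : nat :=
  \max_(d < n.+1 | `[< exists (x0 : 'rV[R]_n) (A : 'M[R]_(d, n)),
      [/\ row_free A, S x0 & forall i, S (x0 + row i A)] >]) d.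

(* Interior of S for the topology of its affine hull, written with balls of
   the sup norm. *)
Definition relint (R : realType) (n : nat) (S : set 'rV[R]_n) :
    set 'rV[R]_n :=
  [set x | S x /\ exists2 e : R, 0 < e & forall z, aff_hull S z ->
    (forall i, `|z 0 i - x 0 i| < e) -> S z].

Definition dilate (R : realType) (n : nat) (l : nat) (S : set 'rV[R]_n) :
    set 'rV[R]_n :=
  [set l%:R *: x | x in S].

Definition lattice_polytope (R : realType) (n : nat) (P : set 'rV[R]_n) :
    Prop :=
  exists V : set 'rV[int]_n, [/\ finite_set V, V !=set0
    & P = conv_hull [set lattice_pt R m | m in V]].

(* A non-empty face is the locus where a linear functional attains its maximum
   on P; the zero functional gives P itself. *)
Definition face (R : realType) (n : nat) (P Q : set 'rV[R]_n) : Prop :=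
  Q !=set0 /\ exists c : 'rV[R]_n,
    Q = [set x | P x /\ forall z, P z -> dot z c <= dot x c].

Definition faces (R : realType) (n : nat) (P : set 'rV[R]_n) :
    set (set 'rV[R]_n) :=
  [set Q | face P Q].

(* Laurent polynomials live in the field of rational functions F(y). *)

Notation "x %:F" := (tofrac x) : ring_scope.
Notation ratfun F := {fraction {poly F}}.

Definition yvar (F : fieldType) : ratfun F := 'X%:F.

Definition rconst (F : fieldType) (c : F) : ratfun F := c%:P%:F.

(* Laurent polynomials in y with coefficients in S *)
Definition laurent (F : fieldType) (S : set F) : set (ratfun F) :=
  [set g | exists (p : {poly F}) (k : nat),
    (forall i, S p`_i) /\ g = p%:F / yvar F ^+ k].

(* g(1/y). The value does not depend on the representative [repr g]:
   see [at_invyE]. *)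
Definition at_invy (F : fieldType) (g : ratfun F) : ratfun F :=
  (map_poly (@rconst F) \n_(repr g)).[(yvar F)^-1]
    / (map_poly (@rconst F) \d_(repr g)).[(yvar F)^-1].

(* Only the values f Q at the non-empty faces Q of P matter. *)
Definition weight_function (R : realType) (n : nat) (P : set 'rV[R]_n)
    (f : set 'rV[R]_n -> ratfun R[i]) : Prop :=
  forall Q, face P Q -> laurent (range (intr : int -> R[i])) (f Q).

Definition dual_weight (R : realType) (n : nat) (P : set 'rV[R]_n)
    (f : set 'rV[R]_n -> ratfun R[i]) : set 'rV[R]_n -> ratfun R[i] :=
  fun Q => \sum_(E \in [set E | face P E /\ face E Q])
    (1 + yvar R[i]) ^+ (aff_dim E - aff_dim Q)
      * (- yvar R[i]) ^- aff_dim E * at_invy (f E).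

(* The degree of a nonzero polynomial; by convention deg 0 = 0. *)
Definition tdeg (R : realType) (n : nat) (phi : {mpoly R[i][n]}) : nat :=
  (msize phi).-1.

(* The sum of phi over the lattice points of S, for S bounded *)
Definition lattice_sum (R : realType) (n : nat) (phi : {mpoly R[i][n]})
    (S : set 'rV[R]_n) : R[i] :=
  \sum_(m \in [set m | S (lattice_pt R m)]) phi.@[fun i => (m 0 i)%:~R].

Definition Etilde_pos (R : realType) (n : nat) (P : set 'rV[R]_n)
    (phi : {mpoly R[i][n]}) (f : set 'rV[R]_n -> ratfun R[i]) (l : nat) :
    ratfun R[i] :=
  \sum_(Q \in faces P) f Q * (1 + yvar R[i]) ^+ aff_dim Q
    * rconst (lattice_sum phi (relint (dilate l Q))).

Definition E_pos (R : realType) (n : nat) (P : set 'rV[R]_n)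
    (phi : {mpoly R[i][n]}) (f : set 'rV[R]_n -> ratfun R[i]) (l : nat) :
    ratfun R[i] :=
  (1 + yvar R[i]) ^+ tdeg phi * Etilde_pos P phi f l.

Definition interpolates (F : fieldType) (u : nat -> ratfun F)
    (p : {poly ratfun F}) : Prop :=
  (forall i, laurent setT p`_i) /\
  (forall l : nat, (0 < l)%N -> p.[l%:R] = u l).

(* The polynomial in l, with coefficients in F[y, 1/y], whose values at the
   positive integers are given by u. It is unique (see [ipolyE]), and the
   default 0 is taken only if there is no such polynomial. *)
Definition ipoly (F : fieldType) (u : nat -> ratfun F) : {poly ratfun F} :=
  xget 0 [set p | interpolates u p].

Definition Etilde (R : realType) (n : nat) (P : set 'rV[R]_n)
    (phi : {mpoly R[i][n]}) (f : set 'rV[R]_n -> ratfun R[i]) (l : int) :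
    ratfun R[i] :=
  (ipoly (Etilde_pos P phi f)).[l%:~R].

Definition Ehr (R : realType) (n : nat) (P : set 'rV[R]_n)
    (phi : {mpoly R[i][n]}) (f : set 'rV[R]_n -> ratfun R[i]) (l : int) :
    ratfun R[i] :=
  (ipoly (E_pos P phi f)).[l%:~R].

Lemma ipolyE (F : numFieldType) (u : nat -> ratfun F) (p : {poly ratfun F}) :
  interpolates u p -> ipoly u = p.
Proof.
move=> up; have [_ hq] : interpolates u (ipoly u).
  by rewrite /ipoly; case: xgetP => [q _ //|/(_ p)].
case: up => _ hp; apply/eqP; rewrite -subr_eq0; apply: contraT => d0.
pose s := [seq l.+1%:R : ratfun F | l <- iota 0 (size (ipoly u - p))].
have inj : injective (fun l : nat => l.+1%:R : ratfun F).
  move=> a b /= /eqP; rewrite -!(rmorph_nat (@tofrac {poly F})) tofrac_eq.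
  by rewrite -!(rmorph_nat (@polyC F)) (inj_eq (@polyC_inj _)) eqr_nat => /eqP[].
have: (size s < size (ipoly u - p)%R)%N.
  apply: max_poly_roots => //.
    apply/allP => _ /mapP[l _ ->]; rewrite /root !hornerE.
    by rewrite hq // hp // subrr.
  by rewrite (map_inj_uniq inj) iota_uniq.
by rewrite size_map size_iota ltnn.
Qed.

Lemma ratfun_repr (F : fieldType) (g : ratfun F) :
  g = (\n_(repr g))%:F / (\d_(repr g))%:F.
Proof.
have d0 : (\d_(repr g))%:F != 0 :> ratfun F.
  by rewrite tofrac_eq0 denom_ratioP.
apply/(mulIf d0); rewrite mulfVK // -{1}(reprK g).
unlock tofrac; rewrite -[LHS]FracField.pi_mul; apply/eqP.
rewrite FracField.equivf_def /FracField.mulf.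
by rewrite !numden_Ratio ?oner_eq0 ?mulr1 ?denom_ratioP // mulrC.
Qed.

Lemma horner_invy_neq0 (F : fieldType) (q : {poly F}) : q != 0 ->
  (map_poly (@rconst F) q).[(yvar F)^-1] != 0.
Proof.
move=> q0; have y0 : yvar F != 0 by rewrite tofrac_eq0 polyX_eq0.
pose k := (size q).-1; have sq : size q = k.+1 by rewrite prednK ?size_poly_gt0.
pose r : {poly F} := \sum_(i < k.+1) q`_i *: 'X^(k - i).
have : r != 0.
  apply: contraNneq q0 => /(congr1 (fun s : {poly F} => s`_0)).
  rewrite coef0 coef_sum big_ord_recr /= subnn coefZ coefXn mulr1 big1 => [|i _].
    by rewrite add0r -lead_coef_eq0 => /eqP.
  by rewrite coefZ coefXn eq_sym subn_eq0 leqNgt ltn_ord mulr0.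
rewrite -(tofrac_eq0 r); apply: contraNneq => qy0.
suff -> : r%:F = yvar F ^+ k * (map_poly (@rconst F) q).[(yvar F)^-1].
  by rewrite qy0 mulr0.
rewrite (@horner_coef_wide _ k.+1) ?(leq_trans (size_poly _ _)) ?sq //.
rewrite mulr_sumr rmorph_sum /=; apply: eq_bigr => i _.
rewrite coef_map_id0 ?/rconst ?rmorph0 // -mul_polyC rmorphM rmorphXn /=.
rewrite mulrCA exprVn; congr (_ * _).
have ik : (i <= k)%N by rewrite -ltnS.
apply: (mulIf (expf_neq0 i y0)).
by rewrite divfK ?expf_neq0 // -exprD subnK.
Qed.

Lemma at_invyE (F : fieldType) (p q : {poly F}) : q != 0 ->
  at_invy (p%:F / q%:F) = (map_poly (@rconst F) p).[(yvar F)^-1]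
                        / (map_poly (@rconst F) q).[(yvar F)^-1].
Proof.
move=> q0; rewrite /at_invy; set g := p%:F / q%:F.
have dn0 : \d_(repr g) != 0 by apply: denom_ratioP.
have := ratfun_repr g; rewrite {1}/g => /eqP.
rewrite eqr_div ?tofrac_eq0 // -!tofracM tofrac_eq => /eqP pq.
have mapM a b : map_poly (@rconst F) (a * b)
    = map_poly (@rconst F) a * map_poly (@rconst F) b.
  exact: (rmorphM (map_poly (@tofrac _ \o @polyC F))).
apply/eqP; rewrite eqr_div ?horner_invy_neq0 //.
by rewrite -!hornerM -!mapM pq mulrC.
Qed.

(* Main.v *)
(** The lattice points of the dilates of a lattice polytope Q are the integral
    points, sliced by height, of the cone over Q.  A generic lifting of the
    vertices triangulates this cone; perturbing every point by a small multiple
    of a generic vector q in the interior of the cone assigns it to exactly one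
    half-open simplicial cone, and perturbing by -q assigns every interior point
    to exactly one of the complementary half-open cones.  In a half-open
    simplicial cone the points are c + sum_i k_i w_i with c in a finite box and
    k_i >= 0, and passing to the complementary half-open cone replaces c and k_i
    by -c and -(k_i + 1).  Reciprocity thus reduces to sums of a polynomial psi
    over the k >= 0 with k_1 + ... + k_r = N, where it follows from the
    one-dimensional case, i.e. from the existence of indefinite sums.

    This gives polynomials p_Q with p_Q(l) = sum over Relint(lQ) and
    p_Q(-l) = (-1)^(dim Q + deg phi) * sum over lQ.  As lQ is the disjoint union
    of the relative interiors of the lE for the faces E of Q, the theorem becomes
    an exchange of summations, using (1 + 1/y)(-y) = -(1 + y). *)

From HB Require Import structures.
Require Import Defs.
From mathcomp Require Import all_boot all_order all_algebra.
From mathcomp Require Import finmap boolp classical_sets functions cardinality fsbigop.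
From mathcomp Require Import reals complex mpoly.
From mathcomp Require Import ring lra zify.

Set Implicit Arguments.
Unset Strict Implicit.
Unset Printing Implicit Defensive.

Import Order.TTheory GRing.Theory Num.Theory.
Local Open Scope ring_scope.
Local Open Scope classical_set_scope.

(** * Sums of polynomials over the lattice points of dilated standard simplices *)

(** All vertices sit at height 1 of the cone, so adding a generator w_i raises the dilation factor
    by exactly 1; hence the sums are true polynomials in l, without a periodic part. Half-open cells
    avoid inclusion-exclusion over the walls of a triangulation: the cone and its interior are
    disjoint unions indexed by the same maximal cells, which all carry the same sign, so the
    identities for the cells simply add up. Reciprocity turns relative interiors into closed faces;
    splitting these again and collecting the terms of one face is what produces D(f). *)

Lemma indefinite_sum (F : numFieldType) (g : {poly F}) :
  exists T : {poly F}, forall x, T.[x + 1] - T.[x] = g.[x].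
Proof.
have [m] := ubnP (size g); elim: m g => // m IH g sg.
have [->|g0] := eqVneq g 0; first by exists 0 => x; rewrite !horner0 subrr.
pose d := (size g).-1; have sd : size g = d.+1 by rewrite prednK ?size_poly_gt0.
(* The difference of a X^(d+1) has the same leading term as g; [h] is g minus that difference, of
   smaller degree. *)
pose a := g`_d / d.+1%:R.
pose h := \poly_(i < d) (g`_i - a * 'C(d.+1, i)%:R).
have [|T hT] := IH h.
  by apply: leq_ltn_trans (size_poly _ _) _; rewrite -ltnS -sd.
exists (T + a *: 'X^(d.+1)) => x.
rewrite ![(T + _).[_]]hornerD opprD addrACA hT !hornerZ !hornerXn.
rewrite horner_poly (horner_coef g) sd big_ord_recr /= [x + 1]addrC exprDn.
rewrite big_ord_recr /= big_ord_recr /=.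
under [X in a * (X + _ + _)]eq_bigr do rewrite expr1n mul1r.
rewrite !expr1n !mul1r binn mulr1n.
rewrite -[X in a * (_ + X + _)]mulr_natr binSn.
rewrite -mulrBr addrK mulrDr addrA mulr_sumr -big_split /=.
have d0 : d.+1%:R != 0 :> F by rewrite pnatr_eq0.
congr (_ + _); last first.
  by rewrite mulrC -mulrA [_ * a]mulrC /a divfK // mulrC.
by apply: eq_bigr => i _; rewrite -mulr_natr; ring.
Qed.

(* With [T] an indefinite sum, [T b - T a] is the sum over [a <= x < b] if
   [a <= b] and minus the sum over [b <= x < a] otherwise. *)
Lemma sum_reciprocity (F : numFieldType) (q : {poly {poly F}}) :
  exists p : {poly F}, forall N : nat,
    \sum_(j < N.+1) q.[j%:R%:P].[N%:R] = p.[N%:R]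
    /\ \sum_(j < N) q.[(- j.+1%:R)%:P].[- N.+1%:R] = - p.[- N.+1%:R] :> F.
Proof.
have qE (x y : F) : q.[x%:P].[y] = \sum_(i < size q) (q`_i).[y] * x ^+ i.
  rewrite (horner_coef q) horner_sum; apply: eq_bigr => i _.
  by rewrite -polyC_exp !hornerE.
have [T hT] : exists T : nat -> {poly F},
    forall i x, (T i).[x + 1] - (T i).[x] = x ^+ i.
  have /choice [T hT] : forall i, exists t : {poly F},
    forall x, t.[x + 1] - t.[x] = x ^+ i.
    move=> i; have [t ht] := indefinite_sum 'X^i : exists T : {poly F}, _; exists t => x.
    by rewrite ht hornerXn.
  by exists T.
(* The shift by 1 makes the range of summation 0 <= x < N + 1; at -N-1 the bound becomes -N, and
   T(-N) - T(0) is minus the sum over -N <= x < 0. *)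
exists (\sum_(i < size q) q`_i * ((T i) \Po ('X + 1%:P) - (T i).[0]%:P)) => N.
have E x : (\sum_(i < size q)
    q`_i * (T i \Po ('X + 1%:P) - ((T i).[0])%:P)).[x] =
    \sum_(i < size q) (q`_i).[x] * ((T i).[x + 1] - (T i).[0]).
  rewrite horner_sum; apply: eq_bigr => i _.
  by rewrite hornerM hornerD hornerN hornerC horner_comp hornerD hornerX hornerC.
rewrite !E; split.
  under eq_bigr do rewrite qE.
  rewrite exchange_big /=; apply: eq_bigr => i _.
  rewrite -mulr_sumr; congr (_ * _).
  under eq_bigr do rewrite -hT.
  rewrite -(big_mkord xpredT (fun j => (T i).[j%:R + 1] - (T i).[j%:R])).
  under eq_bigr do rewrite natr1.
  by rewrite telescope_sumr // natr1.
under eq_bigr do rewrite qE.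
rewrite exchange_big -sumrN /=; apply: eq_bigr => i _.
rewrite -mulr_sumr -mulrN; congr (_ * _).
rewrite opprB -[N.+1%:R]natr1 opprD subrK.
under eq_bigr do rewrite -hT.
rewrite -(big_mkord xpredT (fun j => (T i).[- j.+1%:R + 1] - (T i).[- j.+1%:R])).
under eq_bigr do rewrite -natr1 opprD subrK -[X in - X - 1]/(_%:R) -opprD natr1 -opprB.
by rewrite sumrN telescope_sumr // opprB oppr0.
Qed.

(* Sums over the [k] with [\sum_i k i = N] are written as coefficients of ['X^N] in
   products of polynomials, so that the induction on [r] is a convolution. *)
Lemma monomial_sum_reciprocity (F : numFieldType) (r : nat) (e : 'I_r.+1 -> nat) :
  exists g : {poly F}, forall K N : nat, (N < K)%N ->
    (\prod_i \sum_(j < K) j%:R ^+ e i *: 'X^j)`_N = g.[N%:R]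
    /\ (\prod_i \sum_(j < K) (- j.+1%:R) ^+ e i *: 'X^(j.+1))`_N.+1
       = (-1) ^+ r * g.[- N.+1%:R].
Proof.
have coefA K d N : (N < K)%N ->
    (\sum_(j < K) (j%:R : F) ^+ d *: 'X^j)`_N = N%:R ^+ d.
  move=> NK; rewrite coef_sum (bigD1 (Ordinal NK)) //= coefZ coefXn eqxx mulr1.
  rewrite big1 ?addr0 // => i iN; rewrite coefZ coefXn.
  by rewrite eq_sym -[N]/(val (Ordinal NK)) val_eqE (negbTE iN) mulr0.
have coefB K d N : (N < K)%N ->
    (\sum_(j < K) (- j.+1%:R : F) ^+ d *: 'X^(j.+1))`_N.+1 = (- N.+1%:R) ^+ d.
  move=> NK; rewrite coef_sum (bigD1 (Ordinal NK)) //= coefZ coefXn eqxx mulr1.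
  rewrite big1 ?addr0 // => i iN; rewrite coefZ coefXn.
  by rewrite eqSS eq_sym -[N]/(val (Ordinal NK)) val_eqE (negbTE iN) mulr0.
have coefB0 K d : (\sum_(j < K) (- j.+1%:R : F) ^+ d *: 'X^(j.+1))`_0 = 0.
  by rewrite coef_sum big1 // => i _; rewrite coefZ coefXn mulr0.
elim: r e => [|r IH] e.
  exists 'X^(e ord0) => K N NK; rewrite !big_ord_recl !big_ord0 !mulr1.
  by rewrite coefA // coefB // !hornerXn mul1r.
have [g hg] := IH (fun i => e (lift ord0 i)).
(* One variable is peeled off: x is its value and y the total, so that g is evaluated at what
   remains for the other variables. *)
pose q : {poly {poly F}} := 'X^(e ord0) * (map_poly polyC g \Po ('X%:P - 'X)).
have qE (x y : F) : q.[x%:P].[y] = x ^+ e ord0 * g.[y - x].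
  rewrite hornerM hornerXn hornerM -polyC_exp hornerC; congr (_ * _).
  rewrite horner_comp hornerD hornerN hornerC hornerX.
  by rewrite -[(map_poly _ g).[_]]/(g \Po ('X - x%:P)) horner_comp !hornerE.
have [p hp] := sum_reciprocity q.
exists p => K N NK; rewrite !(@big_ord_recl _ _ _ r.+1).
have [<- hB] := hp N; split.
  rewrite coefM; apply: eq_bigr => -[j /= jN] _.
  rewrite ltnS in jN.
  rewrite coefA ?(leq_ltn_trans _ NK) // qE.
  have [E _] := hg K (N - j)%N (leq_ltn_trans (leq_subr _ _) NK).
  rewrite E.
  by rewrite natrB.
(* No factor has a constant term, so both end terms of the convolution vanish; the N terms left
   match the second sum in [sum_reciprocity]. *)
rewrite coefM (@big_ord_recl _ _ _ N.+1) /=.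
rewrite coefB0 mul0r add0r (@big_ord_recr _ _ _ N) /=.
rewrite subnn coef0_prod.
have -> : \prod_(i < r.+1) (\sum_(j < K)
    (- j.+1%:R : F) ^+ e (lift ord0 i) *: 'X^(j.+1))`_0 = 0.
  by rewrite (bigD1 ord0) //= coefB0 mul0r.
rewrite mulr0 addr0.
rewrite exprS mulN1r mulNr -mulrN -hB mulr_sumr; apply: eq_bigr => j _.
have jN := ltn_ord j.
rewrite /bump /= add1n coefB ?(ltn_trans _ NK) // qE mulrCA; congr (_ * _).
have -> : (N.+1 - j.+1)%N = (N - j.+1).+1 by rewrite subSS subnSK.
have [|_ ->] := hg K (N - j.+1)%N; first by apply: leq_ltn_trans NK; apply: leq_subr.
congr (_ * g.[_]); rewrite subnSK // natrB ?(ltnW jN) //.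
by rewrite -[N.+1%:R]natr1 -[j.+1%:R]natr1; ring.
Qed.

(** Linear extension from monomials. The bound [K] only makes the set of tuples finite: as K > N, it
    excludes no tuple with the given sum. *)
Lemma mpoly_sum_reciprocity (F : numFieldType) (r : nat) (psi : {mpoly F[r.+1]}) :
  exists g : {poly F}, forall K N : nat, (N < K)%N ->
    \sum_(k : {ffun 'I_r.+1 -> 'I_K} | (\sum_i k i)%N == N)
       psi.@[fun i => (k i)%:R] = g.[N%:R]
    /\ \sum_(k : {ffun 'I_r.+1 -> 'I_K} | (\sum_i (k i).+1)%N == N.+1)
         psi.@[fun i => - (k i).+1%:R] = (-1) ^+ r * g.[- N.+1%:R].
Proof.
have /choice [G hG] := fun m : 'X_{1..r.+1} => @monomial_sum_reciprocity F r m.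
have distr K N (c : nat -> F) (s : nat -> nat) (m : 'X_{1..r.+1}) :
    (\prod_i \sum_(j < K) c j ^+ m i *: 'X^(s j))`_N
    = \sum_(k : {ffun 'I_r.+1 -> 'I_K} | (\sum_i s (k i))%N == N)
        \prod_i c (k i) ^+ m i.
  rewrite bigA_distr_bigA /= coef_sum [RHS]big_mkcond /=.
  apply: eq_bigr => k _; rewrite scaler_prod -expr_sum coefZ coefXn eq_sym.
  by case: ifP => _; rewrite ?mulr1 ?mulr0.
exists (\sum_(m <- msupp psi) psi@_m *: G m) => K N NK.
rewrite !horner_sum mulr_sumr; split.
  under eq_bigr do rewrite mevalE.
  rewrite exchange_big /=; apply: eq_bigr => m _.
  by rewrite -mulr_sumr hornerZ; have [<- _] := hG m K N NK; rewrite -(distr _ _ _ id).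
under eq_bigr do rewrite mevalE.
rewrite exchange_big /=; apply: eq_bigr => m _.
rewrite -mulr_sumr hornerZ mulrCA; have [_ <-] := hG m K N NK.
by rewrite -(distr _ _ (fun j => - j.+1%:R) S).
Qed.

(** * Lattice points of half-open simplices *)

(** Vertices lifted to height 1: the rows generate the cone over the polytope spanned by the rows of
    [W]. *)
Definition homogenize (R : nzRingType) (k n : nat) (W : 'M[R]_(k, n)) : 'M[R]_(k, n + 1) :=
  row_mx W (const_mx 1).

Lemma homogenize_mul (R : nzRingType) (k n : nat) (U : 'M[R]_(k, n)) (a : 'rV_k) (x : 'rV_n) t :
  row_mx x t%:M = a *m homogenize U <-> x = a *m U /\ \sum_j a 0 j = t.
Proof.
rewrite /homogenize mul_mx_row; split=> [/eq_row_mx[-> /matrixP/(_ 0 0)]|[-> at1]].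
  rewrite !mxE eqxx mulr1n => ->; split=> //.
  by apply: eq_bigr => i _; rewrite mxE mulr1.
congr row_mx; apply/matrixP => i j; rewrite !ord1 !mxE eqxx mulr1n -at1.
by apply: eq_bigr => s _; rewrite mxE mulr1.
Qed.

Lemma map_homogenize (R : nzRingType) (k n : nat) (U : 'M[int]_(k, n)) :
  map_mx (intr : int -> R) (homogenize U) = homogenize (map_mx intr U).
Proof.
by rewrite /homogenize map_row_mx; congr row_mx; apply/matrixP => i j; rewrite !mxE.
Qed.

(* [d i] tells whether the facet opposite to the vertex [i] is removed. *)
Definition half_open (R : realFieldType) (k : nat) (d : 'I_k -> bool) (a : 'rV[R]_k) : Prop :=
  forall i, if d i then 0 < a 0 i else 0 <= a 0 i.

Definition slice (R : realFieldType) (k n : nat) (W : 'M[int]_(k, n)) (d : 'I_k -> bool)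
    (l : nat) : set 'rV[int]_n :=
  [set m | exists a : 'rV[R]_k, [/\ half_open d a, \sum_i a 0 i = l%:R
     & map_mx intr m = a *m map_mx intr W]].

Lemma int_denominator (k n : nat) (K : 'M[rat]_(k, n)) :
  exists D : nat, (0 < D)%N /\ exists K' : 'M[int]_(k, n),
    map_mx intr K' = D%:R *: K.
Proof.
pose D := (\prod_(p : 'I_k * 'I_n) `|denq (K p.1 p.2)|)%N.
exists D; split; first by apply: prodn_gt0 => p; rewrite absz_gt0 denq_neq0.
have DK i j : exists z : int, z%:~R = D%:R * K i j.
  rewrite /D (bigD1 (i, j)) //= natrM mulrAC natr_absz gtr0_norm ?denq_gt0 //.
  rewrite [_ * K i j]mulrC -numqE /=.
  by set c := (\prod_(p | _) _)%N; exists (numq (K i j) * c%:Z); rewrite intrM.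
have /choice [f hf] := fun p : 'I_k * 'I_n => DK p.1 p.2.
exists (\matrix_(i, j) f (i, j)); apply/matrixP => i j.
by rewrite !mxE hf.
Qed.

(** Row-freeness descends to the rationals because the entries are integral. [D] will serve as a
    common denominator of the barycentric coordinates of lattice points. *)
Lemma int_right_inverse (R : realFieldType) (k n : nat) (W : 'M[int]_(k, n)) :
  row_free (map_mx (intr : int -> R) W) ->
  exists D : nat, (0 < D)%N /\ exists K : 'M[int]_(n, k), W *m K = D%:R%:M.
Proof.
have -> : map_mx (intr : int -> R) W = map_mx (ratr : rat -> R) (map_mx intr W).
  by apply/matrixP => i j; rewrite !mxE ratr_int.
rewrite row_free_map => /row_freeP[K WK].
have [D [D0 [K' hK]]] := int_denominator K; exists D; split => //; exists K'.
suff: map_mx intr (W *m K') = map_mx (intr : int -> rat) D%:R%:M.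
  by move/matrixP => H; apply/matrixP => i j; have := H i j; rewrite [LHS]mxE [RHS]mxE => /intr_inj.
by rewrite map_mxM /= hK -scalemxAr WK map_scalar_mx /= rmorph_nat scalemx1.
Qed.

Section SliceParametrization.
Variables (R : realFieldType) (r n : nat) (W : 'M[int]_(r.+1, n)).
Variables (D : nat) (K : 'M[int]_(n + 1, r.+1)).
Hypotheses (D0 : (0 < D)%N) (WK : homogenize W *m K = D%:R%:M).

Local Notation box := {ffun 'I_r.+1 -> 'I_D}.

(* The barycentric coordinates of the lattice points of a slice are [A / D] with
   [A i = corner d rho i + D * k i], where [0 < corner d rho i <= D] if [d i] and
   [0 <= corner d rho i < D] otherwise. *)
Definition corner (d : 'I_r.+1 -> bool) (rho : box) i : nat := rho i + d i.

Definition box_height d rho : nat := (\sum_i corner d rho i) %/ D.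

(** The combination of generators with coefficients [corner d rho / D] is integral, height included;
    such vectors are the lattice points of a half-open fundamental parallelepiped. *)
Definition box_lattice d rho : bool :=
  (D %| \sum_i corner d rho i)%N &&
  [forall j, (D %| \sum_i (corner d rho i)%:Z * W i j)%Z].

(* The division is exact only under [box_lattice d rho]. *)
Definition slice_pt d (rho : box) (k : 'I_r.+1 -> nat) : 'rV[int]_n :=
  \row_j ((\sum_i (corner d rho i + D * k i)%N%:Z * W i j) %/ D)%Z.

Lemma slice_ptE d rho k j : box_lattice d rho ->
  slice_pt d rho (fun i => k i) 0 j * D%:Z = \sum_i (corner d rho i + D * k i)%N%:Z * W i j.
Proof.
case/andP => _ /forallP /(_ j) dj; rewrite mxE divzK //.
have -> : \sum_i (corner d rho i + D * k i)%N%:Z * W i j =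
   \sum_i (corner d rho i)%:Z * W i j + D%:Z * (\sum_i (k i)%:Z * W i j).
  by rewrite mulr_sumr -big_split /=; apply: eq_bigr => i _; rewrite PoszD PoszM; ring.
by apply: rpredD => //; apply: dvdz_mulr.
Qed.

(** Euclidean division by [D] of the integers A_i = D a_i, with remainders in 1..D where the facet
    is removed. [K0] only bounds the quotients, which never exceed [l]. *)
Lemma slice_pt_bij d (l K0 : nat) : (l < K0)%N ->
  set_bij [set x : box * {ffun 'I_r.+1 -> 'I_K0} | box_lattice d x.1 &&
             (box_height d x.1 + \sum_i x.2 i == l)%N]
          (slice R W d l) (fun x => slice_pt d x.1 (fun i => x.2 i)).
Proof.
move=> lK0.
have D0R : (D%:R : R) != 0 by rewrite pnatr_eq0 -lt0n.
have sumA rho (k : 'I_r.+1 -> nat) : box_lattice d rho ->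
    (\sum_i (corner d rho i + D * k i) = D * (box_height d rho + \sum_i k i))%N.
  case/andP => dv _; rewrite big_split /= -big_distrr /= mulnDr; congr (_ + _)%N.
  by rewrite mulnC divnK.
split.
- move=> [rho k] /= /andP[bl /eqP hk].
  exists (\row_i ((corner d rho i + D * k i)%N%:R / D%:R)); split.
  + move=> i; rewrite mxE; case: ifP => di.
      by rewrite divr_gt0 ?ltr0n // /corner di addn1 addSn.
    by rewrite divr_ge0 ?ler0n.
  + under eq_bigr do rewrite mxE.
    by rewrite -mulr_suml -natr_sum sumA // hk natrM mulrAC divff ?mul1r.
  + apply/rowP => j; rewrite !mxE; apply: (mulIf D0R).
    rewrite mulr_suml -[D%:R]/(D%:Z%:~R) -intrM.
    have := slice_ptE (fun i => k i) j bl; rewrite mxE => ->.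
    rewrite rmorph_sum /=; apply: eq_bigr => i _.
    by rewrite !mxE intrM mulrAC divfK.
- move=> [rho k] [rho' k']; rewrite !inE /= => /andP[bl /eqP hk] /andP[bl' /eqP hk'] E.
  pose A (x : box) (y : {ffun 'I_r.+1 -> 'I_K0}) : 'rV[int]_r.+1 :=
    \row_i (corner d x i + D * y i)%N%:Z.
  have EA : A rho k *m homogenize W = A rho' k' *m homogenize W.
    rewrite !mul_mx_row; congr row_mx; apply/rowP => j; rewrite !mxE.
      transitivity (slice_pt d rho (fun i => k i) 0 j * D%:Z).
        by rewrite slice_ptE //; apply: eq_bigr => i _; rewrite !mxE.
      by rewrite E slice_ptE //; apply: eq_bigr => i _; rewrite !mxE.
    under eq_bigr do rewrite !mxE mulr1.
    under [RHS]eq_bigr do rewrite !mxE mulr1.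
    by rewrite -!(big_morph Posz PoszD (erefl 0)) !sumA // hk hk'.
  (* Right multiplication by [K] cancels [homogenize W] up to the factor D. *)
  have /matrixP AA : A rho k = A rho' k'.
    have := congr1 (mulmx^~ K) EA; rewrite -!mulmxA WK !mul_mx_scalar.
    move/matrixP => H; apply/matrixP => i j; have := H i j.
    rewrite [LHS]mxE [RHS]mxE; apply: mulfI.
    by rewrite -[0]/(0%:R) eqr_nat -lt0n.
  have rk i : (rho i + D * k i)%N = (rho' i + D * k' i)%N.
    by have := AA 0 i; rewrite !mxE /corner => -[]; lia.
  congr pair; apply/ffunP => i; apply: val_inj => /=.
    have := congr1 (modn^~ D) (rk i).
    by rewrite /= ![(_ + D * _)%N]addnC ![(D * _)%N]mulnC !modnMDl !modn_small.
  have := congr1 (divn^~ D) (rk i).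
  by rewrite /= ![(_ + D * _)%N]addnC ![(D * _)%N]mulnC !divnMDl // !divn_small // !addn0.
- move=> m [a [ha sa ma]].
  (* As (m, l) is [a *m homogenize W], this integral vector is D a; so D clears the denominators of
     [a]. *)
  pose A := row_mx m (const_mx l%:Z : 'M_1) *m K.
  have mapA i : (A 0 i)%:~R = D%:R * a 0 i.
    suff : map_mx intr A = D%:R *: a by move/matrixP/(_ 0 i); rewrite !mxE.
    rewrite map_mxM /=.
    have -> : D%:R *: a = a *m map_mx intr (homogenize W *m K).
      by rewrite WK map_scalar_mx /= mul_mx_scalar rmorph_nat.
    rewrite map_mxM /= mulmxA; congr (_ *m _).
    rewrite /homogenize !map_row_mx /= mul_mx_row ma; congr row_mx.
    apply/matrixP => i0 j; rewrite !mxE -[LHS]sa; apply: eq_bigr => s _.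
    by rewrite !mxE mulr1 ord1.
  have Ad i : (d i)%:Z <= A 0 i.
    rewrite -(ler_int R) mapA; have := ha i; case: (d i) => h; last first.
      by rewrite mulr_ge0 // ler0n.
    have : 0 < (A 0 i)%:~R :> R by rewrite mapA mulr_gt0 // ltr0n.
    by rewrite ltr0z -mapA ler_int.
  pose B i := absz (A 0%R i - (d i)%:Z)%R.
  have AB i : A 0 i = (d i + B i)%N%:Z.
    by rewrite PoszD /B gez0_abs ?subr_ge0 // addrC subrK.
  have sumAB : (\sum_i (d i + B i))%N = (D * l)%N.
    apply/eqP; rewrite -(eqr_nat R) natr_sum natrM -sa mulr_sumr.
    by apply/eqP; apply: eq_bigr => i _; rewrite -mapA AB.
  have Bk i : (B i %/ D < K0)%N.
    apply: leq_ltn_trans lK0; rewrite -(leq_pmul2r D0) (leq_trans (leq_divM _ _)) //.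
    by rewrite mulnC -sumAB (bigD1 i) //= addnAC; lia.
  pose rho : box := [ffun i => Ordinal (ltn_pmod (B i) D0)].
  pose k : {ffun 'I_r.+1 -> 'I_K0} := [ffun i => Ordinal (Bk i)].
  have cE i : (corner d rho i + D * k i)%N = (d i + B i)%N.
    by rewrite /corner !ffunE /= {3}(divn_eq (B i) D); lia.
  have mE j : \sum_i (corner d rho i + D * k i)%N%:Z * W i j = m 0 j * D%:Z.
    apply: (@intr_inj R); rewrite rmorph_sum /= intrM.
    have /rowP/(_ j) := ma; rewrite !mxE => ->; rewrite mulr_suml.
    apply: eq_bigr => i _; rewrite intrM cE -AB mapA !mxE; ring.
  have sc : (\sum_i corner d rho i + D * \sum_i k i = D * l)%N.
    by rewrite -sumAB big_distrr -big_split /=; apply: eq_bigr => i _; rewrite cE.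
  exists (rho, k) => /=.
    apply/andP; split; last first.
      rewrite -(eqn_pmul2l D0) -sc mulnDr [(D * box_height _ _)%N]mulnC divnK //.
      by rewrite -(dvdn_addl _ (dvdn_mulr (\sum_i k i) (dvdnn D))) sc dvdn_mulr.
    apply/andP; split.
      by rewrite -(dvdn_addl _ (dvdn_mulr (\sum_i k i) (dvdnn D))) sc dvdn_mulr.
    apply/forallP => j.
    have -> : \sum_i (corner d rho i)%:Z * W i j =
        m 0 j * D%:Z - D%:Z * \sum_i (k i)%:Z * W i j.
      rewrite -mE mulr_sumr -sumrB; apply: eq_bigr => i _.
      by rewrite PoszD PoszM; ring.
    by apply: rpredB; [apply: dvdz_mull | apply: dvdz_mulr].
  apply/rowP => j; rewrite mxE /= mE mulzK //.
  by rewrite -[0]/(0%:Z) eqz_nat -lt0n.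
Qed.
End SliceParametrization.

(** For a fixed box point of height h the sum runs over the k with total l - h, and [psi rho]
    expresses phi as a polynomial in k. In the complementary half-open simplex its place is taken by
    the box point with corner D - c and height r + 1 - h, and the parity of phi supplies (-1)^e. *)
Lemma slice_reciprocity (R : realFieldType) (F : numFieldType) (r n e : nat)
    (W : 'M[int]_(r.+1, n)) (d : 'I_r.+1 -> bool) (phi : {mpoly F[n]}) :
  (forall v, phi.@[fun i => - v i] = (-1) ^+ e * phi.@[v]) ->
  row_free (map_mx (intr : int -> R) (homogenize W)) ->
  exists p : {poly F}, forall l : nat, (0 < l)%N ->
    \sum_(m \in slice R W d l) phi.@[fun i => (m 0 i)%:~R] = p.[l%:R]
    /\ \sum_(m \in slice R W (fun i => ~~ d i) l) phi.@[fun i => (m 0 i)%:~R]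
       = (-1) ^+ (r + e) * p.[- l%:R].
Proof.
move=> phiN Wfree.
have [D [D0 [K WK]]] := int_right_inverse Wfree.
have D0F : (D%:R : F) != 0 by rewrite pnatr_eq0 -lt0n.
have sum_slice (dd : 'I_r.+1 -> bool) l K0 : (l < K0)%N ->
    \sum_(m \in slice R W dd l) phi.@[fun i => (m 0 i)%:~R]
    = \sum_(rho : {ffun 'I_r.+1 -> 'I_D} | box_lattice W dd rho)
        \sum_(k : {ffun 'I_r.+1 -> 'I_K0} | (box_height dd rho + \sum_i k i)%N == l)
          phi.@[fun i => (slice_pt W dd rho (fun i => k i) 0 i)%:~R].
  move=> lK; rewrite (reindex_fsbig _ _ _ _ (slice_pt_bij R D0 WK dd lK)).
  rewrite pair_big_dep /= [RHS]bigfs ?index_enum_uniq //.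
  by move=> x _; rewrite mem_index_enum.
pose y (rho : {ffun 'I_r.+1 -> 'I_D}) (kap : 'I_r.+1 -> F) (j : 'I_n) : F :=
  \sum_i ((corner d rho i)%:R + D%:R * kap i) * (W i j)%:~R / D%:R.
pose Y (rho : {ffun 'I_r.+1 -> 'I_D}) (j : 'I_n) : {mpoly F[r.+1]} :=
  \sum_i ((corner d rho i)%:R%:MP + D%:R *: 'X_i) * ((W i j)%:~R / D%:R)%:MP.
pose psi rho := phi \mPo [tuple Y rho j | j < n].
have psiE rho kap : (psi rho).@[kap] = phi.@[y rho kap].
  rewrite comp_mpoly_meval; apply: meval_eq => j; rewrite tnth_mktuple.
  rewrite raddf_sum; apply: eq_bigr => i _ /=.
  by rewrite mevalM mevalD mevalZ !mevalC mevalXU mulrA.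
have ptE (rho : {ffun 'I_r.+1 -> 'I_D}) (k : 'I_r.+1 -> nat) j : box_lattice W d rho ->
    (slice_pt W d rho k 0 j)%:~R = y rho (fun i => (k i)%:R) j :> F.
  move=> bl; apply: (mulIf D0F); rewrite -[D%:R]/(D%:Z%:~R) -intrM slice_ptE //.
  rewrite rmorph_sum mulr_suml /=; apply: eq_bigr => i _.
  by rewrite intrM divfK // -pmulrn natrD natrM.
have /choice [G hG] := fun rho => mpoly_sum_reciprocity (psi rho).
have c_le rho i : (@corner r D d rho i <= D)%N.
  by rewrite /corner; have := ltn_ord (rho i); case: (d i) => /=; lia.
have height_le (rho : {ffun 'I_r.+1 -> 'I_D}) : (box_height d rho <= r.+1)%N.
  rewrite -(leq_pmul2r D0).
  apply: leq_trans (leq_divM _ _) _; rewrite mulnC.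
  rewrite -[X in (_ <= _ * X)%N]card_ord mulnC -sum_nat_const.
  by apply: leq_sum => i _; apply: c_le.
exists (\sum_(rho | box_lattice W d rho) (G rho \Po ('X - (box_height d rho)%:R%:P))).
have pE x : (\sum_(rho | box_lattice W d rho)
      (G rho \Po ('X - (box_height d rho)%:R%:P))).[x] =
    \sum_(rho | box_lattice W d rho) (G rho).[x - (box_height d rho)%:R].
  by rewrite horner_sum; apply: eq_bigr => rho _; rewrite horner_comp !hornerE.
move=> l l0; rewrite !pE; split.
  rewrite (sum_slice _ _ (l + r).+1) ?ltnS ?leq_addr //.
  apply: eq_bigr => rho bl; set h := box_height d rho.
  have [hl|lh] := leqP h l.
    rewrite -natrB //; have [|<- _] := hG rho (l + r).+1 (l - h)%N.
      by rewrite ltnS (leq_trans (leq_subr _ _)) ?leq_addr.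
    apply: eq_big => [k|k _]; first by rewrite -[in RHS](eqn_add2l h) subnKC.
    by rewrite psiE; apply: meval_eq => j; rewrite ptE.
  (* For h > l there are no points, so [G rho] must vanish at l - h. By reciprocity its value there
     is, up to sign, a sum over tuples of r + 1 positive integers with total h - l <= r, hence
     empty. *)
  have [|_] := hG rho (l + r).+1 (h - l).-1.
    by have := height_le rho; rewrite -/h; lia.
  rewrite prednK ?subn_gt0 // natrB ?(ltnW lh) // opprB.
  rewrite big1 => [/esym/eqP|k /eqP sk]; last first.
    have : (r.+1 <= \sum_i (k i).+1)%N.
      by rewrite -{1}[r.+1]card_ord -sum1_card; apply: leq_sum.
    by rewrite sk; have := height_le rho; rewrite -/h; lia.
  rewrite mulf_eq0 signr_eq0 /= => /eqP ->; rewrite big1 // => k /eqP sk.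
  by have := leq_addr (\sum_i k i) h; rewrite sk leqNgt lh.
rewrite (sum_slice _ _ (l + r).+1) ?ltnS ?leq_addr //.
pose rv (rho : {ffun 'I_r.+1 -> 'I_D}) : {ffun 'I_r.+1 -> 'I_D} :=
  [ffun i => rev_ord (rho i)].
have rvK : involutive rv by move=> rho; apply/ffunP => i; rewrite !ffunE rev_ordK.
rewrite (reindex_inj (inv_inj rvK)) /=.
have cE (rho : {ffun 'I_r.+1 -> 'I_D}) i :
    corner (fun i => ~~ d i) (rv rho) i = (D - corner d rho i)%N.
  by rewrite /corner ffunE /=; have := ltn_ord (rho i); case: (d i) => /=; lia.
have sumC (rho : {ffun 'I_r.+1 -> 'I_D}) :
    (\sum_i corner (fun i => ~~ d i) (rv rho) i + \sum_i corner d rho i = D * r.+1)%N.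
  rewrite -big_split /= -[X in (_ = _ * X)%N]card_ord mulnC -sum_nat_const.
  by apply: eq_bigr => i _; rewrite cE subnK.
have blE (rho : {ffun 'I_r.+1 -> 'I_D}) :
    box_lattice W (fun i => ~~ d i) (rv rho) = box_lattice W d rho.
  rewrite /box_lattice; congr (_ && _).
    have dS : (D %| \sum_i corner (fun i => ~~ d i) (rv rho) i + \sum_i corner d rho i)%N.
      by rewrite sumC dvdn_mulr.
    by apply/idP/idP => h; [rewrite -(dvdn_addr _ h) | rewrite -(dvdn_addl _ h)].
  apply: eq_forallb => j.
  have -> : \sum_i (corner (fun i => ~~ d i) (rv rho) i)%:Z * W i j =
     D%:Z * (\sum_i W i j) - \sum_i (corner d rho i)%:Z * W i j.
    rewrite mulr_sumr -sumrB; apply: eq_bigr => i _.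
    by rewrite cE -subzn ?c_le //; ring.
  by rewrite rpredBl ?dvdz_mulr.
have hE (rho : {ffun 'I_r.+1 -> 'I_D}) : box_lattice W d rho ->
    (box_height (fun i => ~~ d i) (rv rho) + box_height d rho = r.+1)%N.
  move=> bl; apply/eqP; rewrite -(eqn_pmul2r D0) mulnDl !divnK.
  - by rewrite sumC mulnC.
  - by case/andP: bl.
  - by move: bl; rewrite -blE => /andP[].
rewrite (eq_bigl _ _ blE) mulr_sumr; apply: eq_bigr => rho bl.
set h := box_height d rho; have hl := hE _ bl; rewrite -/h in hl.
have hr : (h <= r.+1)%N := height_le rho.
(* At -l - h the tuples satisfy sum (k_i + 1) = l + h, that is h' + sum k_i = l, where h' = r + 1 -
   h is the height of the reversed box point. *)
have [|_] := hG rho (l + r).+1 (l + h).-1.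
  by rewrite prednK ?addn_gt0 ?l0 //; lia.
rewrite prednK ?addn_gt0 ?l0 // natrD opprD exprD mulrAC => <-.
rewrite mulr_suml; apply: eq_big => [k|k _].
  have -> : (\sum_i (k i).+1 = \sum_i k i + r.+1)%N.
    under eq_bigr do rewrite -addn1.
    by rewrite big_split sum_nat_const card_ord muln1.
  rewrite -(eqn_add2r h); congr (_ == _).
  by rewrite addnAC hl addnC.
rewrite psiE [RHS]mulrC -phiN; apply: meval_eq => j.
apply: (mulIf D0F); rewrite -[D%:R]/(D%:Z%:~R) -intrM slice_ptE ?blE //.
rewrite rmorph_sum mulNr mulr_suml -sumrN /=; apply: eq_bigr => i _.
rewrite intrM divfK // -mulNr; congr (_ * _).
rewrite cE -pmulrn natrD natrB // natrM -natr1; ring.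
Qed.

(** * Triangulation of a cone by generic lifting *)

Definition cone (R : realFieldType) (k N : nat) (w : 'M[R]_(k, N)) (x : 'rV[R]_N) : Prop :=
  exists2 a : 'rV[R]_k, (forall j, 0 <= a 0 j) & x = a *m w.

Definition open_cone (R : realFieldType) (k N : nat) (w : 'M[R]_(k, N)) (x : 'rV[R]_N) : Prop :=
  exists2 a : 'rV[R]_k, (forall j, 0 < a 0 j) & x = a *m w.

Lemma mulmx_entry (R : realFieldType) (k N : nat) (a : 'rV[R]_k) (w : 'M[R]_(k, N)) c :
  (a *m w *m c) 0 0 = \sum_j a 0 j * (w *m (c : 'cV_N)) j 0.
Proof. by rewrite -mulmxA mxE. Qed.

(* If [c] separates [x] from the cone of all generators but [u], and [u] is on the
   side of [x], project along [u] onto the kernel of [c] and use induction there. *)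
Lemma farkas (R : realFieldType) (k N : nat) (w : 'M[R]_(k, N)) (x : 'rV[R]_N) :
  cone w x \/
  exists2 c : 'cV[R]_N, (forall j, (w *m c) j 0 <= 0) & 0 < (x *m c) 0 0.
Proof.
elim: k w x => [|k IH] w x.
  have [->|x0] := eqVneq x 0.
    by left; exists 0; [case | rewrite mul0mx].
  right; exists x^T; first by case.
  rewrite mxE lt_neqAle eq_sym sumr_ge0 => [|i _]; last by rewrite mxE -expr2 sqr_ge0.
  rewrite andbT; apply: contraNneq x0 => s0; apply/eqP/rowP => i.
  apply/eqP; rewrite mxE -sqrf_eq0 expr2.
  have := @psumr_eq0P R _ xpredT (fun i => x 0 i * x^T i 0).
  by move=> /(_ _ s0 i isT) <-; rewrite ?mxE // => j _; rewrite mxE -expr2 sqr_ge0.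
move: w; rewrite -[k.+1]/(1 + k)%N => w.
rewrite -(vsubmxK w); move: (usubmx w) (dsubmx w) => u v {w}.
have colE (c : 'cV_N) : (forall j, (col_mx u v *m c) j 0 <= 0) <->
    (u *m c) 0 0 <= 0 /\ forall j, (v *m c) j 0 <= 0.
  rewrite mul_col_mx; split=> [H|[H1 H2] j].
    split=> [|j]; first by have := H (lshift _ 0); rewrite col_mxEu.
    by have := H (rshift _ j); rewrite col_mxEd.
  by rewrite -(splitK j); case: fintype.split => i /=; rewrite ?(col_mxEu, col_mxEd) ?ord1.
have [[a a0 ->]|[c vc xc]] := IH v x.
  left; exists (row_mx 0 a); last by rewrite mul_row_col mul0mx add0r.
  by move=> j; rewrite -(splitK j); case: fintype.split => i /=; rewrite ?(row_mxEl, row_mxEr) ?mxE.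
have [uc|uc] := leP ((u *m c) 0 0) 0; first by right; exists c => //; apply/colE.
set s := (u *m c) 0 0 in uc.
have ucE : u *m c = s%:M := mx11_scalar _.
have [[a a0 ax]|[d vd xd]] := IH (s *: v - v *m c *m u) (s *: x - x *m c *m u).
  (* The coefficient of [u] lost by the projection; it is nonnegative since [c] is positive on x and
     nonpositive on the generators [v]. *)
  left; pose t := ((x *m c) 0 0 - (a *m v *m c) 0 0) / s.
  exists (row_mx t%:M a).
    move=> j; rewrite -(splitK j); case: fintype.split => i /=.
      rewrite row_mxEl mxE ord1 mulr1n divr_ge0 ?(ltW uc) // subr_ge0 (le_trans _ (ltW xc)) //.
      rewrite mulmx_entry -oppr_ge0 -sumrN sumr_ge0 // => j0 _.
      by rewrite -mulrN mulr_ge0 // oppr_ge0.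
    by rewrite row_mxEr.
  rewrite mul_row_col mul_scalar_mx; apply: (@scalerI _ _ s); first by rewrite gt_eqF.
  rewrite scalerDr scalerA mulrC divfK ?gt_eqF //.
  have -> : s *: x = a *m (s *: v - v *m c *m u) + x *m c *m u.
    by rewrite -ax subrK.
  rewrite mulmxBr -scalemxAr scalerBl !mulmxA.
  rewrite -(mul_scalar_mx _ u) -(mul_scalar_mx ((a *m v *m c) 0 0) u) -!mx11_scalar.
  by rewrite addrC addrCA addrC.
(* The form [d] composed with the projection along [u]; it vanishes on [u]. *)
right; exists (s *: d - c *m (u *m d)).
  apply/colE; split.
    by rewrite mulmxBr !mulmxA ucE -scalemxAr -mulmxA mul_scalar_mx subrr mxE.
  by move=> j; have := vd j; rewrite mulmxBl mulmxBr -scalemxAl -scalemxAr !mulmxA.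
by move: xd; rewrite mulmxBl mulmxBr -scalemxAl -scalemxAr !mulmxA.
Qed.

(** On the moment curve every nonzero [c] becomes a nonzero polynomial in t, with finitely many
    roots; a suitable t is found among the positive integers, so all coordinates are positive. *)
Lemma generic_vector (R : realFieldType) (k : nat) (s : seq 'cV[R]_k) :
  (forall c, c \in s -> c != 0) ->
  exists2 v : 'rV[R]_k, forall j, 0 < v 0 j & forall c, c \in s -> (v *m c) 0 0 != 0.
Proof.
move=> s0; pose p (c : 'cV[R]_k) : {poly R} := \sum_j c j 0 *: 'X^j.
have p0 c : c != 0 -> p c != 0.
  move=> c0; apply: contraNneq c0 => pc0; apply/eqP/colP => j.
  have := congr1 (fun q : {poly R} => q`_j) pc0; rewrite coef0 coef_sum.
  rewrite (bigD1 j) //= coefZ coefXn eqxx mulr1 mxE big1 ?addr0 // => i ij.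
  by rewrite coefZ coefXn eq_sym val_eqE (negbTE ij) mulr0.
pose P := \prod_(c <- s) p c.
have P0 : P != 0 by rewrite prodf_seq_neq0; apply/allP => c /s0 /p0.
have [t t0 Pt] : exists2 t, 0 < t & P.[t] != 0.
  apply: contrapT => H.
  have := @max_poly_roots R P [seq i.+1%:R | i <- iota 0 (size P)] P0.
  rewrite size_map size_iota ltnn => H'; suff: false by []; apply: H'.
    apply/allP => _ /mapP[i _ ->]; apply: contrapT => /negP Pi; apply: H.
    by exists i.+1%:R.
  rewrite map_inj_uniq ?iota_uniq // => i j /eqP.
  by rewrite eqr_nat => /eqP[].
(* A point of the moment curve. *)
exists (\row_j t ^+ j) => [j|c cs]; first by rewrite mxE exprn_gt0.
have : (p c).[t] != 0.
  by apply: contraNneq Pt => pt; rewrite /P (big_rem c) //= hornerM pt mul0r.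
rewrite horner_sum mxE; congr (_ != _); apply: eq_bigr => j _.
by rewrite hornerZ hornerXn mxE mulrC.
Qed.

Lemma eventually_all (R : realFieldType) (I : finType) (P : I -> R -> Prop) :
  (forall i, exists2 e, 0 < e & forall t, 0 < t <= e -> P i t) ->
  exists2 e, 0 < e & forall t, 0 < t <= e -> forall i, P i t.
Proof.
move=> H; have /choice[e he] : forall i, exists e, 0 < e /\ forall t, 0 < t <= e -> P i t.
  by move=> i; have [e e0 Pe] := H i; exists e.
exists (\big[Num.min/1]_i e i).
  by apply: lt_bigmin => // i _; case: (he i).
move=> t /andP[t0 te] i; apply: (he i).2; rewrite t0 (le_trans te) //.
exact: bigmin_le_cond.
Qed.

Section RowBases.
Variables (R : realFieldType) (k N : nat) (w : 'M[R]_(k, N)).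
Implicit Types (B : {set 'I_k}) (a b : 'rV[R]_k) (x : 'rV[R]_N).

Definition supported B a : Prop := forall j, j \notin B -> a 0 j = 0.

Definition rmask B : 'M[R]_k := diag_mx (\row_j (j \in B)%:R).

Definition indep_rows B : Prop := forall a, supported B a -> a *m w = 0 -> a = 0.

Definition row_basis B : Prop := indep_rows B /\ (w <= rmask B *m w)%MS.

(** For a row basis [B] and x in the row space, [x *m coord B] is the coordinate vector of x on the
    rows in [B], padded with zeros so that all cells of a triangulation share one type. *)
Definition coord B : 'M[R]_(N, k) := pinvmx (rmask B *m w) *m rmask B.

Lemma mul_rmask B a j : (a *m rmask B) 0 j = a 0 j *+ (j \in B).
Proof. by rewrite mul_mx_diag !mxE mulr_natr. Qed.

Lemma rmask_id B a : supported B a -> a *m rmask B = a.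
Proof.
move=> Ba; apply/rowP => j; rewrite mul_rmask.
by have [|/Ba ->] := boolP (j \in B); rewrite ?mul0rn.
Qed.

Lemma rmask_supported B a : supported B (a *m rmask B).
Proof. by move=> j /negbTE jB; rewrite mul_rmask jB. Qed.

Lemma coord_supported B x : supported B (x *m coord B).
Proof. by rewrite mulmxA; apply: rmask_supported. Qed.

Lemma coordK B x : row_basis B -> (x <= w)%MS -> x *m coord B *m w = x.
Proof.
by move=> [_ wB] xw; rewrite /coord mulmxA -mulmxA mulmxKpV // (submx_trans xw).
Qed.

Lemma coord_unique B a : row_basis B -> supported B a -> a *m w *m coord B = a.
Proof.
move=> bB Ba; apply/eqP; rewrite -subr_eq0; apply/eqP; apply: bB.1.
  by move=> j jB; rewrite mxE coord_supported // mxE Ba // subrr.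
by rewrite mulmxBl coordK ?subrr // submxMl.
Qed.

Lemma indep_rows_basis B : indep_rows B -> exists2 B' : {set 'I_k}, B \subset B' & row_basis B'.
Proof.
move=> iB; pose p := [pred B | `[< indep_rows B >]].
have [B' /maxsetP[/asboolP iB' maxB'] BB'] : {A | maxset p A & B \subset A}.
  by apply: maxset_exists; apply/asboolP.
exists B' => //; split => //; apply/row_subP => j.
have sub b : supported B' b -> (b *m w <= rmask B' *m w)%MS.
  by move/rmask_id => <-; rewrite -mulmxA submxMl.
have [jB|jB] := boolP (j \in B').
  rewrite rowE; apply: sub => i iB1; rewrite mxE eqxx /=.
  by case: eqP jB => // <-; rewrite (negbTE iB1).
have : ~ indep_rows (j |: B').
  move=> /asboolP ij; have := maxB' _ ij (finset.subsetUr _ _) => E.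
  by rewrite -E finset.setU11 in jB.
move=> /existsNP[a] /not_implyP[sa] /not_implyP[aw a0].
have aj : a 0 j != 0.
  apply: contra_notN a0 => /eqP aj; apply: iB' => // i iB1.
  have [->|ij] := eqVneq i j; first by [].
  by apply: sa; rewrite !inE negb_or ij.
have -> : row j w = (delta_mx 0 j - (a 0 j)^-1 *: a) *m w.
  by rewrite mulmxBl -rowE -scalemxAl aw scaler0 subr0.
apply: sub => i iB1; rewrite !mxE eqxx /=.
have [->|ij] := eqVneq i j; first by rewrite mulVf // subrr.
by rewrite (sa i) ?inE ?negb_or ?ij // mulr0 subr0.
Qed.

End RowBases.

Definition supp (R : realFieldType) (k : nat) (a : 'rV[R]_k) : {set 'I_k} :=
  [set j | a 0 j != 0]%SET.

(** Move along a linear dependency until a coefficient vanishes. Up to replacing the dependency by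
    its opposite, the move does not increase the lifted height [a *m om]; the common height 1 of the
    generators makes a move in either direction end. *)
Lemma caratheodory (R : realFieldType) (k N : nat) (w : 'M[R]_(k, N)) (h : 'cV[R]_N)
    (om : 'cV[R]_k) (a : 'rV[R]_k) :
  w *m h = const_mx 1 -> (forall j, 0 <= a 0 j) ->
  exists b : 'rV[R]_k, [/\ forall j, 0 <= b 0 j, b *m w = a *m w,
    (b *m om) 0 0 <= (a *m om) 0 0 & indep_rows w (supp b)].
Proof.
move=> wh; have [m] := ubnP #|supp a|; elim: m a => // m IH a sm a0.
have [ia|] := pselect (indep_rows w (supp a)); first by exists a.
move=> /existsNP[lam0] /not_implyP[slam0] /not_implyP[lamw0 lam00].
have [lam [slam lamw lamn0 lamom]] : exists lam : 'rV[R]_k,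
    [/\ supported (supp a) lam, lam *m w = 0, lam <> 0 & 0 <= (lam *m om) 0 0].
  have [H|/ltW H] := leP 0 ((lam0 *m om) 0 0); first by exists lam0.
  exists (- lam0); split.
  - by move=> j ja; rewrite mxE slam0 ?oppr0.
  - by rewrite mulNmx lamw0 oppr0.
  - by move/eqP; rewrite oppr_eq0 => /eqP.
  - by rewrite mulNmx mxE oppr_ge0.
(* All generators have height 1, so a linear dependency has a positive coefficient. *)
have lamS : \sum_j lam 0 j = 0.
  transitivity ((lam *m w *m h) 0 0); last by rewrite lamw mul0mx mxE.
  by rewrite mulmx_entry wh; apply: eq_bigr => j _; rewrite mxE mulr1.
have [j0 lamj0] : exists j, 0 < lam 0 j.
  apply: contrapT => /forallNP H; apply: lamn0; apply/rowP => j; rewrite mxE.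
  apply: oppr_inj; rewrite oppr0.
  apply: (@psumr_eq0P R _ xpredT (fun j => - lam 0 j)) => //.
    by move=> i _; rewrite oppr_ge0 leNgt; apply/negP/H.
  by rewrite sumrN lamS oppr0.
have [j1 lamj1 minj1] : exists2 j1, 0 < lam 0 j1 &
    forall j, 0 < lam 0 j -> a 0 j1 / lam 0 j1 <= a 0 j / lam 0 j.
  case: (@arg_minP _ R _ j0 (fun j => 0 < lam 0 j) (fun j => a 0 j / lam 0 j) lamj0).
  move=> j1 ? H.
  by exists j1.
pose t := a 0 j1 / lam 0 j1.
have t0 : 0 <= t by rewrite divr_ge0 // ltW.
have [||b [b0 bw bom ib]] := IH (a - t *: lam).
- rewrite -ltnS; apply: leq_trans sm; rewrite ltnS; apply: proper_card.
  apply/fintype.properP; split.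
    apply/fintype.subsetP => j; rewrite !inE; apply: contraNneq => aj.
    by rewrite !mxE slam ?inE ?aj ?eqxx // mulr0 subr0.
  exists j1; last by rewrite !inE !mxE divfK ?subrr ?eqxx ?gt_eqF.
  by apply: contraLR lamj1 => /slam ->; rewrite ltxx.
- move=> j; rewrite !mxE subr_ge0.
  have [lj|lj] := leP (lam 0 j) 0.
    by apply: le_trans (a0 j); apply: mulr_ge0_le0.
  by rewrite -ler_pdivlMr //; apply: minj1.
exists b; split => //.
  by rewrite bw mulmxBl -scalemxAl lamw scaler0 subr0.
apply: (le_trans bom); rewrite mulmxBl -scalemxAl mxE [X in _ + X]mxE [X in - X]mxE.
by rewrite gerBl mulr_ge0.
Qed.

Section RegularTriangulation.
Variables (R : realFieldType) (k N : nat) (w : 'M[R]_(k, N)) (h : 'cV[R]_N).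
Hypothesis wh : w *m h = const_mx 1.
Variable om : 'rV[R]_k.
Hypothesis om_generic : forall (B : {set 'I_k}) j, j \notin B ->
  (row j w *m coord w B *m om^T) 0 0 != om 0 j.
Implicit Types (B : {set 'I_k}) (a : 'rV[R]_k) (x z q : 'rV[R]_N).

(* Lift the generator [row j w] to the height [om 0 j]: [cost B] is the linear form
   that agrees with the lifting on [B], and the regular cells are the projections
   of the lower facets of the lifted cone. *)
Definition cost B x : R := (x *m coord w B *m om^T) 0 0.

Definition regular_cell B : Prop :=
  row_basis w B /\ forall j, cost B (row j w) <= om 0 j.

Definition generic_pt x : Prop :=
  forall B, row_basis w B -> forall j, j \in B -> (x *m coord w B) 0 j != 0.

Lemma costE B a : cost B (a *m w) = \sum_j a 0 j * cost B (row j w).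
Proof.
rewrite /cost; move: (coord w B) => C; rewrite -!mulmxA mxE.
by apply: eq_bigr => j _; rewrite -!row_mul [X in _ = _ * X]mxE mulmxA.
Qed.

Lemma cost_coord B B' x : row_basis w B' -> (x <= w)%MS ->
  cost B x = \sum_j (x *m coord w B') 0 j * cost B (row j w).
Proof. by move=> bB' xw; rewrite -costE coordK. Qed.

Lemma costT B x : cost B x = \sum_j (x *m coord w B) 0 j * om 0 j.
Proof. by rewrite /cost mxE; apply: eq_bigr => j _; rewrite [X in _ * X]mxE. Qed.

(** If z is interior to both cells, [cost B1 <= om] on the generators of [B2] gives
    [cost B1 z <= cost B2 z], and by symmetry equality. A generator of one cell outside the other
    would make the inequality strict, because [om] is generic. *)
Lemma regular_cell_uniq B B' z : (z <= w)%MS -> regular_cell B -> regular_cell B' ->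
  (forall j, j \in B -> 0 < (z *m coord w B) 0 j) ->
  (forall j, j \in B' -> 0 < (z *m coord w B') 0 j) -> B = B'.
Proof.
move=> zw.
have le B1 B2 : regular_cell B1 -> regular_cell B2 ->
    (forall j, j \in B2 -> 0 < (z *m coord w B2) 0 j) -> cost B1 z <= cost B2 z.
  move=> [_ r1] [b2 _] z2; rewrite (cost_coord B1 b2 zw) costT.
  apply: ler_sum => j _; have [/z2 /ltW zj|jB] := boolP (j \in B2).
    exact: ler_wpM2l.
  by rewrite coord_supported // !mul0r.
have sub B1 B2 : regular_cell B1 -> regular_cell B2 -> cost B1 z = cost B2 z ->
    (forall j, j \in B2 -> 0 < (z *m coord w B2) 0 j) -> B2 \subset B1.
  move=> [_ r1] [b2 _] E z2; apply/fintype.subsetP => j jB2; apply: contraT => jB1.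
  have := om_generic jB1; rewrite -/(cost B1 (row j w)) => /negP[].
  rewrite eq_le r1 /= leNgt; apply/negP => lt.
  have : cost B1 z < cost B2 z.
    rewrite (cost_coord B1 b2 zw) costT (bigD1 j) //= [ltRHS](bigD1 j) //=.
    apply: ltr_leD; first by rewrite ltr_pM2l // z2.
    apply: ler_sum => i _; have [/z2 /ltW zi|iB] := boolP (i \in B2).
      exact: ler_wpM2l.
    by rewrite coord_supported // !mul0r.
  by rewrite E ltxx.
move=> rB rB' zB zB'.
have E : cost B z = cost B' z by apply/eqP; rewrite eq_le !le.
by apply/eqP; rewrite finset.eqEsubset (sub B' B) // (sub B B').
Qed.

(** The reduction of [caratheodory] leaves an independent support; in a basis extending it the
    coordinates are the same, and genericity of the point makes them all positive. *)
Lemma feasible_basis a : (forall j, 0 <= a 0 j) -> generic_pt (a *m w) ->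
  exists B, [/\ row_basis w B, forall j, j \in B -> 0 < (a *m w *m coord w B) 0 j
    & cost B (a *m w) <= (a *m om^T) 0 0].
Proof.
move=> a0 gz; have [b [b0 bw bom ib]] := caratheodory om^T wh a0.
have [B sB bB] := indep_rows_basis ib.
have bE : b = a *m w *m coord w B.
  rewrite -bw coord_unique // => j jB; apply/eqP.
  by have := contra (fintype.subsetP sB j) jB; rewrite inE negbK.
exists B; split => // [j jB|]; last by rewrite /cost -bE.
by rewrite lt_neqAle eq_sym gz //= -bE.
Qed.

(** Among the bases whose open cone contains the point, take one of least cost. Were a generator j
    lifted below [cost B], trading a small multiple of its expansion in [B] for the generator itself
    would lead to a cheaper basis, as in a pivot of the simplex method. *)
Lemma regular_cell_exists a : (forall j, 0 <= a 0 j) -> generic_pt (a *m w) ->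
  exists2 B, regular_cell B & forall j, j \in B -> 0 < (a *m w *m coord w B) 0 j.
Proof.
move=> a0 gz; have [B0 [bB0 pB0 _]] := feasible_basis a0 gz.
pose P B := `[< row_basis w B /\ forall j, j \in B -> 0 < (a *m w *m coord w B) 0 j >].
have PB0 : P B0 by apply/asboolP.
case: (@arg_minP _ R _ B0 P (fun B => cost B (a *m w)) PB0) => B /asboolP[bB pB] minB.
exists B => //; split => // j; rewrite leNgt; apply/negP => lt.
pose c := row j w *m coord w B; pose b := a *m w *m coord w B.
have [t t0 ht] : exists2 t, 0 < t & forall s, 0 < s <= t -> forall i, i \in B -> s * c 0 i <= b 0 i.
  apply: (@eventually_all _ _ (fun i s => i \in B -> s * c 0 i <= b 0 i)) => i.
  have [iB|iB] := boolP (i \in B); last by exists 1.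
  have bi := pB i iB; exists (b 0 i / (1 + `|c 0 i|)).
    by rewrite divr_gt0 // ltr_pwDl.
  move=> s /andP[s0 sb] _; apply: (@le_trans _ _ (s * (1 + `|c 0 i|))).
    by rewrite ler_pM2l // (le_trans (ler_norm _)) // lerDr.
  by rewrite -ler_pdivlMr // ltr_pwDl.
pose a' := b - t *: c + t *: delta_mx 0 j.
have wj : (row j w <= w)%MS by apply: row_sub.
have aw' : a' *m w = a *m w.
  rewrite !mulmxDl mulNmx -!scalemxAl -rowE /b /c !coordK ?submxMl //.
  by rewrite subrK.
have a'0 i : 0 <= a' 0 i.
  have -> : a' 0 i = b 0 i - t * c 0 i + t * (i == j)%:R.
    by rewrite /a'; move: (b) (c) => ? ?; rewrite !mxE.
  rewrite addr_ge0 ?mulr_ge0 ?ler0n ?(ltW t0) // subr_ge0.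
  have [iB|iB] := boolP (i \in B); first by apply: (ht t); rewrite ?t0 ?lexx.
  by rewrite !coord_supported // mulr0.
have [|B' [bB' pB' cB']] := feasible_basis a'0; first by rewrite aw'.
have := minB B'; rewrite aw' in pB' cB'.
have -> : P B' by apply/asboolP.
move=> /(_ isT); apply/negP; rewrite -ltNge; apply: le_lt_trans cB' _.
have -> : (a' *m om^T) 0 0 = cost B (a *m w) - t * cost B (row j w) + t * om 0 j.
  rewrite !mulmxDl mulNmx -!scalemxAl -rowE mxE; congr (_ + _); last by rewrite !mxE.
  by rewrite mxE [X in _ + X]mxE [X in - X]mxE.
by rewrite -addrA gtrDl addrC subr_lt0 ltr_pM2l.
Qed.

End RegularTriangulation.

Definition cell (R : realFieldType) (k N : nat) (w : 'M[R]_(k, N)) (B : {set 'I_k})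
    (d : 'I_k -> bool) (x : 'rV[R]_N) : Prop :=
  exists a : 'rV[R]_k, [/\ supported B a,
    forall j, j \in B -> if d j then 0 < a 0 j else 0 <= a 0 j & x = a *m w].

(* Whether [x + t q] lies in the interior of a simplicial cone for all small [t > 0]
   is the membership of [x] in a half-open cone determined by [q]. *)
Lemma perturbed_sign (R : realFieldType) (a b : R) : b != 0 ->
  exists2 e, 0 < e & forall t, 0 < t <= e ->
    a + t * b != 0 /\ (0 < a + t * b) = if b < 0 then 0 < a else 0 <= a.
Proof.
move=> b0; have [->|a0] := eqVneq a 0.
  exists 1 => // t /andP[t0 _]; rewrite add0r mulf_eq0 (gt_eqF t0) pmulr_rgt0 //.
  by split=> //; rewrite lexx ltxx; case: ltgtP b0.
exists (`|a| / (2 * `|b|)); first by rewrite divr_gt0 ?mulr_gt0 ?normr_gt0.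
move=> t /andP[t0]; rewrite ler_pdivlMr ?mulr_gt0 ?normr_gt0 // => tb.
have ab : `|t * b| < `|a|.
  rewrite normrM (gtr0_norm t0); have := normr_gt0 a; rewrite a0 => a1.
  have : 0 < t * `|b| by rewrite mulr_gt0 ?normr_gt0.
  nra.
have -> : (if b < 0 then 0 < a else 0 <= a) = (0 < a).
  by case: ifP => // _; rewrite le_eqVlt eq_sym (negbTE a0).
move: ab; rewrite ltr_norml; case: (ltgtP a 0) a0 => // h _.
  rewrite (ltr0_norm h) => /andP[h1 h2].
  by split; [rewrite lt_eqF; lra | apply/negbTE; rewrite -leNgt; lra].
by rewrite (gtr0_norm h) => /andP[h1 h2]; split; [rewrite gt_eqF; lra | lra].
Qed.

Lemma cell_coord (R : realFieldType) (k N : nat) (w : 'M[R]_(k, N)) B d x :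
  row_basis w B -> (x <= w)%MS ->
  cell w B d x <->
  forall j, j \in B -> if d j then 0 < (x *m coord w B) 0 j else 0 <= (x *m coord w B) 0 j.
Proof.
move=> bB xw; split=> [[a [sa da ->]] j jB|H].
  by rewrite coord_unique //; apply: da.
by exists (x *m coord w B); split => //; [apply: coord_supported | rewrite coordK].
Qed.

Lemma cone_sub (R : realFieldType) (k N : nat) (w : 'M[R]_(k, N)) x :
  cone w x -> (x <= w)%MS.
Proof. by move=> [a _ ->]; apply: submxMl. Qed.

(** For small t > 0 the point x + t q is generic, hence lies in the cone iff it is interior to a
    regular cell, and then to only one. By [perturbed_sign] this is a half-open condition on x
    itself: the facet opposite to j is removed when q has a negative j-th coordinate. The bound on t
    depends on x. *)
Lemma half_open_decomposition (R : realFieldType) (k N : nat) (w : 'M[R]_(k, N))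
    (h : 'cV[R]_N) (om : 'rV[R]_k) (q x : 'rV[R]_N) (d := fun B j => (q *m coord w B) 0 j < 0) :
  w *m h = const_mx 1 ->
  (forall (B : {set 'I_k}) j, j \notin B ->
    (row j w *m coord w B *m om^T) 0 0 != om 0 j) ->
  (q <= w)%MS -> generic_pt w q -> (x <= w)%MS ->
  (exists2 e, 0 < e & forall t, 0 < t <= e ->
     cone w (x + t *: q) <-> exists2 B, regular_cell w om B & cell w B (d B) x)
  /\ (forall B B', regular_cell w om B -> regular_cell w om B' ->
       cell w B (d B) x -> cell w B' (d B') x -> B = B').
Proof.
move=> wh omg qw gq xw.
have [e e0 he] : exists2 e, 0 < e & forall t, 0 < t <= e -> forall p : {set 'I_k} * 'I_k,
    row_basis w p.1 -> p.2 \in p.1 ->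
    ((x + t *: q) *m coord w p.1) 0 p.2 != 0 /\
    (0 < ((x + t *: q) *m coord w p.1) 0 p.2) =
      if d p.1 p.2 then 0 < (x *m coord w p.1) 0 p.2 else 0 <= (x *m coord w p.1) 0 p.2.
  apply: (@eventually_all _ _ (fun (p : {set 'I_k} * 'I_k) t => row_basis w p.1 ->
     p.2 \in p.1 -> _ /\ _)) => -[B j] /=.
  have [[bB jB]|H] := pselect (row_basis w B /\ j \in B); last first.
    by exists 1 => // t _ bB jB; case: H.
  have [e e0 he] := perturbed_sign ((x *m coord w B) 0 j) (gq B bB j jB).
  exists e => // t te _ _; have := he t te.
  rewrite mulmxDl -scalemxAl /d; move: (x *m _) (q *m _) => u v.
  by rewrite !mxE.
have pw t : ((x + t *: q)%R <= w)%MS by rewrite addmx_sub ?scalemx_sub.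
have gp t : 0 < t <= e -> generic_pt w (x + t *: q).
  by move=> te B bB j jB; have [] := he t te (B, j) bB jB.
have cellE t B : 0 < t <= e -> row_basis w B -> cell w B (d B) x <->
    forall j, j \in B -> 0 < ((x + t *: q) *m coord w B) 0 j.
  move=> te bB; rewrite cell_coord //; split=> H j jB;
    have [_ /= E] := he t te (B, j) bB jB.
    by rewrite E; have := H j jB; case: ifP.
  by have := H j jB; rewrite E; case: ifP.
split.
  exists e => // t te; split=> [[a a0 E]|[B rB]].
    have [|B rB pB] := regular_cell_exists wh om a0; first by rewrite -E; apply: gp.
    by exists B => //; apply/(cellE t) => //; [case: rB | rewrite E].
  have bB := rB.1; rewrite (cellE t) // => pB.
  exists ((x + t *: q) *m coord w B); last by rewrite coordK.
  move=> j; have [jB|jB] := boolP (j \in B); first exact: ltW (pB j jB).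
  by rewrite coord_supported.
move=> B B' rB rB'; have te : 0 < e <= e by rewrite e0 lexx.
rewrite (cellE e _ te rB.1) (cellE e _ te rB'.1).
exact: (regular_cell_uniq omg (pw e) rB rB').
Qed.

Theorem cone_triangulation (R : realFieldType) (k N : nat) (w : 'M[R]_(k, N)) (h : 'cV[R]_N) :
  w *m h = const_mx 1 ->
  exists (T : {set {set 'I_k}}) (d : {set 'I_k} -> 'I_k -> bool),
    [/\ forall B, B \in T -> row_basis w B,
        forall x, cone w x <-> exists2 B, B \in T & cell w B (d B) x,
        forall x, open_cone w x <-> exists2 B, B \in T & cell w B (fun j => ~~ d B j) x
      & forall x B B', B \in T -> B' \in T ->
          cell w B (d B) x /\ cell w B' (d B') x \/
          cell w B (fun j => ~~ d B j) x /\ cell w B' (fun j => ~~ d B' j) x -> B = B'].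
Proof.
move=> wh.
(* [om] is generic when it is orthogonal to none of these vectors; they are nonzero because, for j
   outside [B], the j-th entry is -1. *)
pose f1 (p : {set 'I_k} * 'I_k) := (row p.2 w *m coord w p.1)^T - delta_mx p.2 0.
pose s1 := map f1 (filter (fun p : {set 'I_k} * 'I_k => p.2 \notin p.1)
  (enum [set: {set 'I_k} * 'I_k]%SET)).
have [c /mapP[[B j]]|om _ hom] := @generic_vector R k s1.
  rewrite mem_filter /= => /andP[jB _] ->; apply/eqP => /colP /(_ j).
  rewrite 2!mxE coord_supported // !mxE !eqxx add0r => /eqP.
  by rewrite oppr_eq0 oner_eq0.
have omg (B : {set 'I_k}) j : j \notin B -> (row j w *m coord w B *m om^T) 0 0 != om 0 j.
  move=> jB; have /hom : ((row j w *m coord w B)^T - delta_mx j 0) \in s1.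
    by apply/mapP; exists (B, j) => //; rewrite mem_filter jB mem_enum finset.in_setT.
  apply: contraNneq => E; rewrite mulmxBr -colE.
  rewrite -[om *m _]trmxK trmx_mul trmxK mxE [X in X + _]mxE [X in _ + X]mxE [X in - X]mxE.
  by rewrite E subrr.
(* [p *m w] is generic when [p] is orthogonal to none of these columns, whose j-th entry is 1. *)
pose f2 (p : {set 'I_k} * 'I_k) := w *m col p.2 (coord w p.1).
pose s2 := map f2 (filter (fun p : {set 'I_k} * 'I_k => `[< row_basis w p.1 >] && (p.2 \in p.1))
  (enum [set: {set 'I_k} * 'I_k]%SET)).
have [c /mapP[[B j]]|p p0 hp] := @generic_vector R k s2.
  rewrite mem_filter /= => /andP[/andP[/asboolP bB jB] _] ->; apply/eqP => /colP /(_ j).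
  have -> : (w *m col j (coord w B)) j 0 = (row j w *m coord w B) 0 j.
    by move: (coord w B) => C; rewrite colE mulmxA -colE -row_mul [LHS]mxE [RHS]mxE.
  rewrite rowE coord_unique //; last first.
    by move=> i iB; rewrite mxE eqxx; case: eqP iB jB => // -> /negbTE ->.
  by rewrite !mxE !eqxx => /eqP; rewrite oner_eq0.
have gq : generic_pt w (p *m w).
  move=> B bB j jB; have /hp : w *m col j (coord w B) \in s2.
    by apply/mapP; exists (B, j) => //; rewrite mem_filter /= jB andbT mem_enum finset.in_setT andbT;
       apply/asboolP.
  by move: (coord w B) => C; rewrite colE !mulmxA -colE mxE.
have gnq : generic_pt w (- (p *m w)).
  by move=> B bB j jB; rewrite mulNmx mxE oppr_eq0; apply: gq.
have qw : (p *m w <= w)%MS by apply: submxMl.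
have nqw : ((- (p *m w))%R <= w)%MS by rewrite eqmx_opp.
pose T := [set B | `[< regular_cell w om B >]]%SET.
pose d (B : {set 'I_k}) j := (p *m w *m coord w B) 0 j < 0.
have cellN B x : row_basis w B -> cell w B (fun j => ~~ d B j) x <->
    cell w B (fun j => (- (p *m w) *m coord w B) 0 j < 0) x.
  move=> bB; have E j : j \in B -> ((- (p *m w) *m coord w B) 0 j < 0) = ~~ d B j.
    by move=> jB; rewrite mulNmx mxE oppr_lt0 /d -leNgt lt_neqAle eq_sym gq.
  by split=> -[a [sa da xa]]; exists a; split=> // j jB; have := da j jB; rewrite E.
have TP B : B \in T <-> regular_cell w om B by rewrite inE; split=> /asboolP.
exists T, d; split.
- by move=> B /TP[].
- move=> x; have [xw|xw] := boolP (x <= w)%MS; last first.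
    split=> [/cone_sub|[B _ [a [_ _ xa]]]]; first by rewrite (negbTE xw).
    by rewrite xa submxMl in xw.
  have [[e e0 he] _] := half_open_decomposition wh omg qw gq xw.
  (* With q = [p *m w], x lies in the cone iff x + t q does for small t > 0. One direction adds
     positive coefficients; the other is the closedness of the cone: a hyperplane that strictly cuts
     off x still cuts off x + t q. *)
  have [cx|[c wc xc]] := farkas w x.
    have te : 0 < e <= e by rewrite e0 lexx.
    split=> // _; have [] := he e te; case=> [|B rB cB _].
      have [a a0 ->] := cx; exists (a + e *: p); last by rewrite mulmxDl -scalemxAl.
      by move=> j; rewrite !mxE addr_ge0 // mulr_ge0 ?(ltW e0) // ltW.
    by exists B => //; apply/TP.
  have ncone y : 0 < (y *m c) 0 0 -> ~ cone w y.
    move=> yc [a a0 ya]; move: yc; rewrite ya mulmx_entry ltNge => /negP; apply.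
    by rewrite -oppr_ge0 -sumrN sumr_ge0 // => j _; rewrite -mulrN mulr_ge0 // oppr_ge0.
  split=> [/ncone|[B /TP rB cB]]; first by move=> /(_ xc).
  pose t := Num.min e ((x *m c) 0 0 / (1 + `|(p *m w *m c) 0 0|) / 2).
  have te : 0 < t <= e.
    by rewrite ge_min lexx lt_min e0 !divr_gt0 // ltr_pwDl.
  exfalso; have [_ H] := he t te; have : cone w (x + t *: (p *m w)) by apply: H; exists B.
  apply: ncone; rewrite mulmxDl -scalemxAl mxE [X in _ + X]mxE.
  have : t * (1 + `|(p *m w *m c) 0 0|) <= (x *m c) 0 0 / 2.
    by rewrite -ler_pdivlMr ?ltr_pwDl // mulrAC ge_min lexx orbT.
  have := ler_norm (- (p *m w *m c) 0 0); rewrite normrN.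
  case/andP: te => t0 _; nra.
- move=> x; have [xw|xw] := boolP (x <= w)%MS; last first.
    split=> [[a _ xa]|[B _ [a [_ _ xa]]]]; by rewrite xa submxMl in xw.
  have [[e e0 he] _] := half_open_decomposition wh omg nqw gnq xw.
  split=> [[a a0 xa]|[B /TP rB /(cellN _ _ rB.1) cB]].
    (* x is interior iff x - u q lies in the cone for small u > 0: subtract u p from positive
       coefficients, or add it to nonnegative ones. *)
    have [t t0 ht] : exists2 t, 0 < t & forall s, 0 < s <= t -> forall j, s * p 0 j <= a 0 j.
      apply: (@eventually_all _ _ (fun j s => s * p 0 j <= a 0 j)) => j.
      exists (a 0 j / p 0 j); first by rewrite divr_gt0.
      by move=> s /andP[_]; rewrite ler_pdivlMr.
    pose u := Num.min e t.
    have ue : 0 < u <= e by rewrite ge_min lexx lt_min e0 t0.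
    have ut : 0 < u <= t by rewrite ge_min lexx orbT lt_min e0 t0.
    have [] := he u ue; case=> [|B rB cB _].
      exists (a - u *: p); last by rewrite mulmxBl -scalemxAl scalerN xa.
      by move=> j; rewrite !mxE subr_ge0; apply: ht.
    by exists B; [apply/TP | apply/cellN => //; case: rB].
  have te : 0 < e <= e by rewrite e0 lexx.
  have [_ H] := he e te; have [|a a0 E] := H; first by exists B.
  exists (a + e *: p); last by rewrite mulmxDl -scalemxAl -E scalerN subrK.
  by move=> j; rewrite !mxE ltr_wpDl // mulr_gt0.
- move=> x B B' /TP rB /TP rB' [[cB cB']|[cB cB']].
    have xw : (x <= w)%MS by case: cB => a [_ _ ->]; apply: submxMl.
    have [_ H] := half_open_decomposition wh omg qw gq xw.
    exact: H rB rB' cB cB'.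
  have xw : (x <= w)%MS by case: cB => a [_ _ ->]; apply: submxMl.
  have [_ H] := half_open_decomposition wh omg nqw gnq xw.
  by apply: (H _ _ rB rB'); apply/cellN => //; [case: rB | case: rB'].
Qed.

(** * Reciprocity for cones over lattice polytopes *)

Lemma fsum_partition (V : zmodType) (I J : choiceType) (D : set I) (S : set J)
    (A : I -> set J) (F : J -> V) :
  finite_set D -> finite_set S ->
  (forall j, S j <-> exists2 i, D i & A i j) ->
  (forall i i' j, D i -> D i' -> A i j -> A i' j -> i = i') ->
  \sum_(j \in S) F j = \sum_(i \in D) \sum_(j \in A i) F j.
Proof.
move=> fD fS SA dis.
have -> : \sum_(i \in D) \sum_(j \in A i) F j
    = \sum_(i \in D) \sum_(j \in S) (if j \in A i then F j else 0).
  apply: eq_fsbigr => i; rewrite inE => Di; rewrite -fsbig_mkcondr; apply: eq_fsbigl.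
  by apply/seteqP; split=> j /= => [Aj|[]//]; split=> //; apply/SA; exists i.
rewrite exchange_fsbig //; apply: eq_fsbigr => j; rewrite inE => /SA[i Di Aj].
transitivity (\sum_(i' \in D) (if i' \in [set i' | A i' j] then F j else 0)); last first.
  apply: eq_fsbigr => i' _.
  have -> // : (j \in A i') = (i' \in [set i' | A i' j]).
  by apply/idP/idP; rewrite !inE.
rewrite -fsbig_mkcondr (_ : _ `&` _ = [set i]) ?fsbig_set1 //.
by apply/seteqP; split=> i' /= => [[Di' Aj']|->] //; apply: dis Aj.
Qed.

Lemma slice_finite (R : realFieldType) (k n : nat) (W : 'M[int]_(k, n))
    (d : 'I_k -> bool) (l : nat) :
  (0 < k)%N -> row_free (map_mx (intr : int -> R) (homogenize W)) ->
  finite_set (slice R W d l).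
Proof.
case: k W d => // r W d _ Wfree; have [D [D0 [K WK]]] := int_right_inverse Wfree.
have [_ _ surj] := slice_pt_bij R D0 WK d (ltnSn l).
by apply: (sub_finite_set surj); apply: finite_image; apply: finite_finset.
Qed.

Lemma slice_reciprocity_gt0 (R : realFieldType) (F : numFieldType) (r n e : nat)
    (W : 'M[int]_(r, n)) (d : 'I_r -> bool) (phi : {mpoly F[n]}) :
  (0 < r)%N ->
  (forall v, phi.@[fun i => - v i] = (-1) ^+ e * phi.@[v]) ->
  row_free (map_mx (intr : int -> R) (homogenize W)) ->
  exists p : {poly F}, forall l : nat, (0 < l)%N ->
    \sum_(m \in slice R W d l) phi.@[fun i => (m 0 i)%:~R] = p.[l%:R]
    /\ \sum_(m \in slice R W (fun i => ~~ d i) l) phi.@[fun i => (m 0 i)%:~R]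
       = (-1) ^+ (r.-1 + e) * p.[- l%:R].
Proof. by case: r W d => // r W d _; apply: slice_reciprocity. Qed.

Section CellSlices.
Variables (R : realFieldType) (k n : nat) (U : 'M[int]_(k, n)) (B : {set 'I_k}).
Let w : 'M[R]_(k, n + 1) := map_mx intr (homogenize U).
Let f : 'I_#|B| -> 'I_k := enum_val.
Hypothesis bB : row_basis w B.

Lemma rowsub1_entry (a : 'rV[R]_#|B|) i : (a *m rowsub f 1%:M) 0 (f i) = a 0 i.
Proof.
rewrite mxE (bigD1 i) //= !mxE eqxx mulr1 big1 ?addr0 // => j ji.
by rewrite !mxE (inj_eq enum_val_inj) (negbTE ji) mulr0.
Qed.

Lemma rowsub1_supported (a : 'rV[R]_#|B|) : supported B (a *m rowsub f 1%:M).
Proof.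
move=> j jB; rewrite mxE big1 // => i _; rewrite !mxE.
by case: eqP => [E|_]; rewrite ?mulr0 //; move: jB; rewrite -E enum_valP.
Qed.

Lemma colsubK (a : 'rV[R]_k) : supported B a -> colsub f a *m rowsub f 1%:M = a.
Proof.
move=> sa; apply/rowP => j; have [jB|jB] := boolP (j \in B).
  by rewrite -(enum_rankK_in jB jB) rowsub1_entry mxE.
by rewrite sa // rowsub1_supported.
Qed.

Lemma homogenize_rowsub : map_mx intr (homogenize (rowsub f U)) = rowsub f w.
Proof.
by apply/matrixP => i j; rewrite /w /homogenize !mxE; case: fintype.split => ?; rewrite !mxE.
Qed.

Lemma basis_row_free : row_free (map_mx (intr : int -> R) (homogenize (rowsub f U))).
Proof.
rewrite homogenize_rowsub.
apply: inj_row_free => v; rewrite rowsubE mulmxA => v0.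
apply/rowP => i; rewrite -rowsub1_entry (bB.1 _ _ v0) ?mxE //.
exact: rowsub1_supported.
Qed.

(** All cells have the same number of generators, so the sign in [slice_reciprocity] is common to
    them and their contributions can be added. *)
Lemma basis_card : #|B| = \rank w.
Proof.
have := basis_row_free; rewrite homogenize_rowsub => /eqP <-.
apply/eqP; rewrite eqn_leq; apply/andP; split; last first.
  apply: mxrankS; apply: submx_trans bB.2 _; apply/row_subP => j.
  rewrite row_mul rowE -(colsubK (@rmask_supported _ _ B _)) -mulmxA -rowsubE.
  exact: submxMl.
by apply: mxrankS; rewrite rowsubE submxMl.
Qed.

Lemma cell_slice (d : 'I_k -> bool) (l : nat) (m : 'rV[int]_n) :
  cell w B d (row_mx (map_mx intr m) l%:R%:M) <->
  slice R (rowsub f U) (fun i => d (f i)) l m.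
Proof.
have split_eq (a : 'rV[R]_k) : row_mx (map_mx intr m) l%:R%:M = a *m w <->
    map_mx intr m = a *m map_mx intr U /\ \sum_i a 0 i = l%:R.
  by rewrite /w map_homogenize; apply: homogenize_mul.
have sumS (a : 'rV[R]_#|B|) : \sum_i (a *m rowsub f 1%:M) 0 i = \sum_i a 0 i.
  have -> : \sum_i (a *m rowsub f 1%:M) 0 i = (a *m rowsub f 1%:M *m const_mx 1 : 'M_1) 0 0.
    by rewrite mxE; apply: eq_bigr => i _; rewrite [X in _ * X]mxE mulr1.
  rewrite -mulmxA -rowsubE mxE; apply: eq_bigr => i _.
  by rewrite !mxE mulr1.
have mapU : map_mx intr (rowsub f U) = rowsub f 1%:M *m map_mx (intr : int -> R) U.
  by rewrite -rowsubE; apply/matrixP => i j; rewrite !mxE.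
split=> [[a [sa da /split_eq[ma suma]]]|[a [da suma ma]]].
  exists (colsub f a); split.
  - by move=> i; rewrite mxE; apply: da; apply: enum_valP.
  - by rewrite -sumS colsubK.
  - by rewrite mapU mulmxA colsubK.
exists (a *m rowsub f 1%:M); split.
- exact: rowsub1_supported.
- by move=> j jB; rewrite -(enum_rankK_in jB jB) rowsub1_entry; apply: da.
- by apply/split_eq; rewrite sumS; split=> //; rewrite ma mapU mulmxA.
Qed.
End CellSlices.

Theorem cone_reciprocity (R : realFieldType) (F : numFieldType) (k n e : nat)
    (U : 'M[int]_(k, n)) (phi : {mpoly F[n]})
    (w := map_mx (intr : int -> R) (homogenize U))
    (pt := fun m (l : nat) => row_mx (map_mx (intr : int -> R) m) l%:R%:M : 'rV_(n + 1)) :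
  (0 < k)%N ->
  (forall v, phi.@[fun i => - v i] = (-1) ^+ e * phi.@[v]) ->
  (forall l, finite_set [set m : 'rV[int]_n | cone w (pt m l)]) /\
  exists p : {poly F}, forall l : nat, (0 < l)%N ->
    \sum_(m \in [set m | open_cone w (pt m l)]) phi.@[fun i => (m 0 i)%:~R] = p.[l%:R]
    /\ \sum_(m \in [set m | cone w (pt m l)]) phi.@[fun i => (m 0 i)%:~R]
       = (-1) ^+ ((\rank w).-1 + e) * p.[- l%:R].
Proof.
move=> k0 phiN.
have wh : w *m col_mx 0 (1 : 'M_1) = const_mx 1.
  rewrite /w /homogenize map_row_mx mul_row_col mulmx0 add0r mulmx1.
  by apply/matrixP => i j; rewrite !mxE.
have [T [d [bT coneT openT disT]]] := cone_triangulation wh.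
have rw : (0 < \rank w)%N.
  rewrite lt0n mxrank_eq0; apply/eqP => w0.
  have /matrixP/(_ (Ordinal k0) 0) := wh; rewrite w0 mul0mx !mxE => /eqP.
  by rewrite eq_sym oner_eq0.
have cT B : B \in T -> (0 < #|B|)%N by move=> BT; rewrite (basis_card (bT _ BT)).
have fin B dd l : B \in T -> finite_set [set m : 'rV[int]_n | cell w B dd (pt m l)].
  move=> BT; apply: sub_finite_set (slice_finite _ l (cT _ BT) (basis_row_free (bT _ BT))).
    by move=> m /cell_slice; apply.
have finS (S : set 'rV_(n + 1)) (dd : {set 'I_k} -> 'I_k -> bool) l :
    (forall x, S x <-> exists2 B, B \in T & cell w B (dd B) x) ->
    finite_set [set m : 'rV[int]_n | S (pt m l)].
  move=> hS.
  apply: (sub_finite_set (B := \bigcup_(B in [set` T]) [set m | cell w B (dd B) (pt m l)])).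
    by move=> m /= /hS[B BT cB]; exists B.
  by apply: bigcup_finite => [|B BT]; [exact: finite_finpred | exact: fin].
have finC l := finS (cone w) d l coneT.
split=> //.
have /choice[G hG] : forall B, exists p : {poly F}, B \in T -> forall l, (0 < l)%N ->
    \sum_(m \in [set m | cell w B (fun j => ~~ d B j) (pt m l)])
       phi.@[fun i => (m 0 i)%:~R] = p.[l%:R]
    /\ \sum_(m \in [set m | cell w B (d B) (pt m l)]) phi.@[fun i => (m 0 i)%:~R]
       = (-1) ^+ ((\rank w).-1 + e) * p.[- l%:R].
  move=> B; have [BT|] := boolP (B \in T); last by exists 0.
  (* The complementary facets are passed, because the polynomial must give the sum over the open
     cone at positive l; their complement is [d] again. *)
  have [p hp] := slice_reciprocity_gt0 (fun i => ~~ d B (enum_val i)) (cT B BT) phiN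
    (basis_row_free (bT B BT)).
  exists p => _ l l0; have [E1 E2] := hp l l0.
  have cE dd : [set m | cell w B dd (pt m l)] =
      slice R (rowsub (enum_val : 'I_#|B| -> 'I_k) U) (fun i => dd (enum_val i)) l.
    by apply/seteqP; split=> m /cell_slice.
  rewrite !cE -(basis_card (bT B BT)) -E1 -E2; split=> //.
  by apply: eq_fsbigl; congr slice; apply/funext => i; rewrite negbK.
exists (\sum_(B in T) G B) => l l0.
have sumT (H : {set 'I_k} -> F) : \sum_(B \in [set` T]) H B = \sum_(B in T) H B.
  by rewrite [RHS]bigfs ?index_enum_uniq // => B _; rewrite mem_index_enum.
rewrite !horner_sum mulr_sumr; split.
  rewrite (fsum_partition (D := [set` T])
    (A := fun B => [set m | cell w B (fun j => ~~ d B j) (pt m l)])).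
  - by rewrite sumT; apply: eq_bigr => B BT; have [] := hG B BT l l0.
  - exact: finite_finpred.
  - exact: (finS _ _ _ openT).
  - by move=> m; apply: openT.
  - by move=> B B' m BT BT' c c'; apply: (disT _ _ _ BT BT'); right; split; [exact: c | exact: c'].
rewrite (fsum_partition (D := [set` T]) (A := fun B => [set m | cell w B (d B) (pt m l)])).
- by rewrite sumT; apply: eq_bigr => B BT; have [] := hG B BT l l0.
- exact: finite_finpred.
- exact: finC.
- by move=> m; apply: coneT.
- by move=> B B' m BT BT' c c'; apply: (disT _ _ _ BT BT'); left; split; [exact: c | exact: c'].
Qed.

(** * Polytopes, their relative interiors and their faces *)

Definition hull (R : realType) (k n : nat) (U : 'M[R]_(k, n)) : set 'rV[R]_n :=
  [set x | exists a : 'rV[R]_k, [/\ forall j, 0 <= a 0 j, \sum_j a 0 j = 1 & x = a *m U]].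

Lemma sum_mulmx_weights (R : comNzRingType) (k s : nat) (A : 'M[R]_(s, k)) (a : 'rV_s) :
  (forall i, \sum_j A i j = 1) -> \sum_i a 0 i = 1 -> \sum_j (a *m A) 0 j = 1.
Proof.
move=> A1 a1; under eq_bigr do rewrite mxE.
by rewrite exchange_big /= -[RHS]a1; apply: eq_bigr => i _; rewrite -mulr_sumr A1 mulr1.
Qed.

Lemma sum_uniform_weights (R : numFieldType) (k : nat) :
  (0 < k)%N -> \sum_j (const_mx k%:R^-1 : 'rV[R]_k) 0 j = 1.
Proof.
move=> k0; under eq_bigr do rewrite mxE.
by rewrite sumr_const card_ord -[_ *+ _]mulr_natr mulVf // pnatr_eq0 -lt0n.
Qed.

Lemma conv_hull_rows (R : realType) (k n : nat) (U : 'M[R]_(k, n)) :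
  conv_hull (range (fun j => row j U)) = hull U.
Proof.
apply/seteqP; split=> x.
  move=> [s [v [a [vU a0 a1 ->]]]].
  have /choice[f hf] : forall i, exists j, row j U = v i.
    by move=> i; have [j _ <-] := vU i; exists j.
  pose A : 'M[R]_(s, k) := \matrix_(i, j) (f i == j)%:R.
  exists ((\row_i a i) *m A); split.
  - move=> j; rewrite mxE sumr_ge0 // => i _; rewrite !mxE mulr_ge0 ?ler0n //; exact: a0.
  - apply: sum_mulmx_weights => [i|]; last by rewrite -[RHS]a1; apply: eq_bigr => i _; rewrite mxE.
    by rewrite (bigD1 (f i)) //= mxE eqxx big1 ?addr0 // => j jf; rewrite mxE eq_sym (negbTE jf).
  - rewrite -mulmxA mulmx_sum_row; apply: eq_bigr => i _; rewrite mxE; congr (_ *: _).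
    rewrite -hf row_mul mulmx_sum_row (bigD1 (f i)) //= !mxE eqxx scale1r.
    by rewrite big1 ?addr0 // => j jf; rewrite !mxE eq_sym (negbTE jf) scale0r.
move=> [a [a0 a1 ->]]; exists k, (fun j => row j U), (fun j => a 0 j); split => //.
  by rewrite mulmx_sum_row.
Qed.

Lemma hull_row (R : realType) (k n : nat) (U : 'M[R]_(k, n)) j : hull U (row j U).
Proof.
exists (delta_mx 0 j); split; last by rewrite rowE.
  by move=> i; rewrite mxE ler0n.
rewrite (bigD1 j) //= mxE !eqxx big1 ?addr0 // => i ij.
by rewrite mxE (negbTE ij).
Qed.

Lemma aff_hull_hull (R : realType) (k n : nat) (U : 'M[R]_(k, n)) z :
  aff_hull (hull U) z -> exists b : 'rV[R]_k, \sum_j b 0 j = 1 /\ z = b *m U.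
Proof.
move=> [s [v [a [vU a1 ->]]]].
have /choice[A hA] : forall i, exists b : 'rV[R]_k, \sum_j b 0 j = 1 /\ v i = b *m U.
  by move=> i; have [b [_ b1 ->]] := vU i; exists b.
exists ((\row_i a i) *m \matrix_i A i); split.
  apply: sum_mulmx_weights => [i|].
    by rewrite -(hA i).1; apply: eq_bigr => j _; rewrite mxE.
  by rewrite -[RHS]a1; apply: eq_bigr => i _; rewrite mxE.
rewrite -mulmxA mulmx_sum_row; apply: eq_bigr => i _.
by rewrite mxE row_mul rowK (hA i).2.
Qed.

(** A relative interior point x can be pushed slightly further away from the barycentre q of the
    generators, to a point z of the hull; x is then a combination of z and q with all weights
    positive. Conversely, a small displacement inside the affine hull is [c *m U] with [c] small and
    of total 0, which positive weights absorb. *)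
Lemma relint_hull (R : realType) (k n : nat) (U : 'M[R]_(k, n)) x : (0 < k)%N ->
  relint (hull U) x <->
  exists a : 'rV[R]_k, [/\ forall j, 0 < a 0 j, \sum_j a 0 j = 1 & x = a *m U].
Proof.
move=> k0; have k0R : 0 < k%:R :> R by rewrite ltr0n.
split=> [[Sx [e e0 he]]|[a [a0 a1 xa]]].
  pose u : 'rV[R]_k := const_mx k%:R^-1.
  have u1 : \sum_j u 0 j = 1 by apply: sum_uniform_weights.
  pose q := u *m U.
  have Sq : hull U q by exists u; split => // j; rewrite mxE invr_ge0 ltW.
  pose t := e / (1 + \sum_i `|x 0 i - q 0 i|).
  have s0 : 0 < 1 + \sum_i `|x 0 i - q 0 i| by rewrite ltr_pwDl // sumr_ge0.
  have t0 : 0 < t by rewrite divr_gt0.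
  have [c [c0 c1 zc]] : hull U ((1 + t) *: x - t *: q).
    apply: he => [|i].
      exists 2%N, (fun i => if i == 0 then x else q), (fun i => if i == 0 then 1 + t else - t).
      split; first by move=> i; case: ifP.
        by rewrite !big_ord_recl big_ord0 /= addr0 addrK.
      by rewrite !big_ord_recl big_ord0 /= addr0 scaleNr.
    rewrite !mxE (_ : _ - _ = t * (x 0 i - q 0 i)); last by rewrite !mxE; ring.
    rewrite normrM (gtr0_norm t0) -[ltRHS](divfK (lt0r_neq0 s0)) ltr_pM2l //.
    rewrite (bigD1 i) //=; have : 0 <= \sum_(j | j != i) `|x 0 j - q 0 j| by rewrite sumr_ge0.
    lra.
  have t1 : 0 < 1 + t by rewrite addr_gt0.
  exists ((1 + t)^-1 *: (c + t *: u)); split.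
  - by move=> j; rewrite !mxE mulr_gt0 ?invr_gt0 // ltr_wpDl // mulr_gt0 ?invr_gt0.
  - under eq_bigr do rewrite !mxE.
    rewrite -mulr_sumr big_split /= c1 -mulr_sumr.
    rewrite (_ : \sum_(j < k) k%:R^-1 = 1); first by rewrite mulr1 mulVf ?gt_eqF.
    by rewrite -[RHS]u1; apply: eq_bigr => j _; rewrite mxE.
  - by rewrite -scalemxAl mulmxDl -scalemxAl -zc subrK scalerA mulVf ?gt_eqF // scale1r.
split; first by exists a; split => // j; rewrite ltW.
pose w := homogenize U; pose K := pinvmx w.
have [e e0 he] : exists2 e, 0 < e & forall t, 0 < t <= e ->
    forall j, t * (1 + \sum_i `|K i j|) <= a 0 j.
  apply: (@eventually_all _ _ (fun j t => t * (1 + \sum_i `|K i j|) <= a 0 j)) => j.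
  have s0 : 0 < 1 + \sum_i `|K i j| by rewrite ltr_pwDl // sumr_ge0.
  exists (a 0 j / (1 + \sum_i `|K i j|)); first by rewrite divr_gt0.
  by move=> t /andP[_]; rewrite ler_pdivlMr.
exists e => // z /aff_hull_hull[b [b1 zb]] hz.
pose c := row_mx (z - x) 0%:M *m K.
have [zx c1] : z - x = c *m U /\ \sum_j c 0 j = 0.
  apply/homogenize_mul; rewrite mulmxKpV //.
  have -> : row_mx (z - x) 0%:M = (b - a) *m w.
    apply/homogenize_mul; rewrite mulmxBl -zb -xa; split => //.
    under eq_bigr do rewrite !mxE.
    by rewrite sumrB b1 a1 subrr.
  exact: submxMl.
exists (a + c); split; last by rewrite mulmxDl -xa -zx addrC subrK.
  move=> j; rewrite mxE.
  have ea := he e _ j; rewrite e0 lexx in ea; have {}ea := ea isT.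
  have cj : `|c 0 j| <= e * \sum_i `|K i j|.
    rewrite mxE mulr_sumr; apply: le_trans (ler_norm_sum _ _ _) _; apply: ler_sum => i _.
    rewrite normrM ler_wpM2r // -(splitK i); case: (fintype.split i) => i' /=.
      by rewrite row_mxEl !mxE ltW // hz.
    by rewrite row_mxEr mxE mul0rn normr0 ltW.
  have := ler_norm (- c 0 j); rewrite normrN; nra.
by under eq_bigr do rewrite mxE; rewrite big_split /= c1 addr0.
Qed.

Lemma dilate_hull (R : realType) (k n l : nat) (U : 'M[R]_(k, n)) :
  dilate l (hull U) = hull (l%:R *: U).
Proof.
apply/seteqP; split=> x.
  by move=> [_ [a [a0 a1 ->]] <-]; exists a; split=> //; rewrite -scalemxAr.
move=> [a [a0 a1 ->]]; exists (a *m U); last by rewrite -scalemxAr.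
by exists a.
Qed.

Lemma dilate_hull_cone (R : realType) (k n l : nat) (U : 'M[R]_(k, n)) x : (0 < l)%N ->
  dilate l (hull U) x <-> cone (homogenize U) (row_mx x l%:R%:M).
Proof.
move=> l0; have l0R : l%:R != 0 :> R by rewrite pnatr_eq0 -lt0n.
rewrite dilate_hull; split=> [[a [a0 a1 ->]]|[a a0 /homogenize_mul[-> al]]].
  exists (l%:R *: a); first by move=> j; rewrite mxE mulr_ge0.
  apply/homogenize_mul; rewrite -scalemxAr scalemxAl; split=> //.
  by under eq_bigr do rewrite mxE; rewrite -mulr_sumr a1 mulr1.
exists (l%:R^-1 *: a); split.
- by move=> j; rewrite mxE mulr_ge0 ?invr_ge0.
- by under eq_bigr do rewrite mxE; rewrite -mulr_sumr al mulVf.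
- by rewrite -scalemxAr -scalemxAl scalerA divff // scale1r.
Qed.

Lemma relint_dilate_cone (R : realType) (k n l : nat) (U : 'M[R]_(k, n)) x :
  (0 < k)%N -> (0 < l)%N ->
  relint (dilate l (hull U)) x <-> open_cone (homogenize U) (row_mx x l%:R%:M).
Proof.
move=> k0 l0; have l0R : 0 < l%:R :> R by rewrite ltr0n.
rewrite dilate_hull relint_hull //; split=> [[a [a0 a1 ->]]|[a a0 /homogenize_mul[-> al]]].
  exists (l%:R *: a); first by move=> j; rewrite mxE mulr_gt0.
  apply/homogenize_mul; rewrite -scalemxAr scalemxAl; split=> //.
  by under eq_bigr do rewrite mxE; rewrite -mulr_sumr a1 mulr1.
exists (l%:R^-1 *: a); split.
- by move=> j; rewrite mxE mulr_gt0 ?invr_gt0.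
- by under eq_bigr do rewrite mxE; rewrite -mulr_sumr al mulVf ?gt_eqF.
- by rewrite -scalemxAr -scalemxAl scalerA divff ?gt_eqF // scale1r.
Qed.

Lemma relint_dilate (R : realType) (k n l : nat) (U : 'M[R]_(k, n)) x : (0 < k)%N -> (0 < l)%N ->
  relint (dilate l (hull U)) x <-> relint (hull U) (l%:R^-1 *: x).
Proof.
move=> k0 l0; have l0R : l%:R != 0 :> R by rewrite pnatr_eq0 -lt0n.
rewrite dilate_hull !relint_hull //; split=> -[a [a0 a1 E]]; exists a; split=> //.
  by rewrite E -scalemxAr scalerA mulVf // scale1r.
by rewrite -scalemxAr -E scalerA divff // scale1r.
Qed.

Lemma hull_homogenize (R : realType) (k n : nat) (U : 'M[R]_(k, n)) x :
  hull U x -> (row_mx x 1%:M <= homogenize U)%MS.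
Proof.
move=> [a [_ a1 xa]]; have -> : row_mx x 1%:M = a *m homogenize U by apply/homogenize_mul.
exact: submxMl.
Qed.

(** Points are affinely independent when their lifts to height 1 are linearly independent; the span
    of the lifts is generated by one of them and the differences, which have height 0. *)
Lemma aff_dim_hull (R : realType) (k n : nat) (U : 'M[R]_(k, n)) : (0 < k)%N ->
  aff_dim (hull U) = (\rank (homogenize U)).-1.
Proof.
move=> k0; pose x0 := row (Ordinal k0) U; pose Df := U - const_mx 1 *m x0.
have hx0 : hull U x0 by apply: hull_row.
apply/eqP; rewrite eqn_leq; apply/andP; split.
  apply/bigmax_leqP => d /asboolP[y0 [A [fA Sy0 SA]]].
  pose M := col_mx (row_mx y0 1%:M) (row_mx A 0) : 'M_(1 + d, n + 1).
  have fM : row_free M.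
    apply: inj_row_free => v; rewrite -(hsubmxK v) mul_row_col !mul_mx_row mulmx0 mulmx1.
    rewrite add_row_mx addr0 => /eqP; rewrite row_mx_eq0 => /andP[/eqP H /eqP v0].
    move: H; rewrite v0 mul0mx add0r => /eqP; rewrite (mulmx_free_eq0 _ fA) => /eqP ->.
    by rewrite row_mx0.
  have Mw : (M <= homogenize U)%MS.
    rewrite col_mx_sub hull_homogenize //=; apply/row_subP => i.
    have -> : row i (row_mx A 0) = row_mx (y0 + row i A) 1%:M - row_mx y0 1%:M.
      by rewrite opp_row_mx add_row_mx subrr addrAC subrr add0r row_row_mx row0.
    by apply: addmx_sub; rewrite ?eqmx_opp hull_homogenize.
  have := mxrankS Mw; rewrite (eqP fM) add1n.
  by case: (\rank _).
have dn : (\rank Df < n.+1)%N by rewrite ltnS rank_leq_col.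
apply: (@leq_trans (\rank Df)); last first.
  apply: (leq_bigmax_cond (Ordinal dn)); apply/asboolP.
  exists x0, (rowsub (maxrankfun Df) Df); split => //; first exact: maxrowsub_free.
  move=> i; have -> : x0 + row i (rowsub (maxrankfun Df) Df) = row (maxrankfun Df i) U.
    apply/rowP => j; rewrite !mxE big_ord_recl big_ord0 !mxE mul1r addr0.
    by rewrite addrC subrK.
  exact: hull_row.
have H : (homogenize U <= col_mx (row_mx x0 1%:M) (row_mx Df 0))%MS.
  have -> : homogenize U = row_mx (const_mx 1) 1%:M *m col_mx (row_mx x0 1%:M) (row_mx Df 0).
    rewrite mul_row_col !mul_mx_row mul1mx mulmx1 mul1mx add_row_mx addr0.
    by rewrite /homogenize /Df addrC subrK.
  exact: submxMl.
have := leq_trans (mxrankS H) (rank_leq_row _).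
have := mxrankS H; rewrite -addsmxE => r1.
have r2 := leq_trans r1 (mxrank_adds_leqif _ _).1.
have r3 := rank_leq_row (row_mx x0 (1%:M : 'M[R]_1)).
have r4 : (\rank (row_mx Df (0 : 'M[R]_(k, 1))) <= \rank Df)%N.
  have -> : row_mx Df (0 : 'M[R]_(k, 1)) = Df *m row_mx 1%:M 0.
    by rewrite mul_mx_row mulmx1 mulmx0.
  exact: mxrankM_maxl.
lia.
Qed.

Lemma aff_dim_sub (R : realType) (n : nat) (S S' : set 'rV[R]_n) :
  S `<=` S' -> (aff_dim S <= aff_dim S')%N.
Proof.
move=> SS; apply/bigmax_leqP => d /asboolP[x0 [A [fA Sx SA]]].
apply: leq_bigmax_cond; apply/asboolP; exists x0, A; split => //; first exact: SS.
by move=> i; apply: SS.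
Qed.

Lemma dot_mulmx (R : realType) (k n : nat) (U : 'M[R]_(k, n)) (a : 'rV_k) c :
  dot (a *m U) c = \sum_j a 0 j * dot (row j U) c.
Proof.
rewrite /dot; under eq_bigr do rewrite mxE mulr_suml.
rewrite exchange_big /=; apply: eq_bigr => j _; rewrite mulr_sumr.
by apply: eq_bigr => i _; rewrite mxE mulrA.
Qed.

Lemma convex_sum_max (R : realType) (k : nat) (a : 'rV[R]_k) (g : 'I_k -> R) M :
  (forall j, 0 <= a 0 j) -> \sum_j a 0 j = 1 -> (forall j, g j <= M) ->
  M <= \sum_j a 0 j * g j -> forall j, 0 < a 0 j -> g j = M.
Proof.
move=> a0 a1 gM ag j aj; apply/eqP; rewrite eq_sym -subr_eq0.
have : a 0 j * (M - g j) = 0.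
  apply: (@psumr_eq0P R _ xpredT (fun j => a 0 j * (M - g j))) => //.
    by move=> i _; rewrite mulr_ge0 // subr_ge0.
  apply/eqP; rewrite eq_le sumr_ge0 ?andbT => [|i _]; last by rewrite mulr_ge0 // subr_ge0.
  under eq_bigr do rewrite mulrBr.
  by rewrite sumrB -mulr_suml a1 mul1r subr_le0.
by move/eqP; rewrite mulf_eq0 gt_eqF.
Qed.

Definition vertices_in (R : realType) (k n : nat) (U : 'M[R]_(k, n)) (Q : set 'rV[R]_n) :
  {set 'I_k} := [set j | `[< Q (row j U) >]]%SET.

Definition subhull (R : realType) (k n : nat) (U : 'M[R]_(k, n)) (J : {set 'I_k}) :
  set 'rV[R]_n := hull (rowsub (enum_val : 'I_#|J| -> 'I_k) U).

Lemma subhullP (R : realType) (k n : nat) (U : 'M[R]_(k, n)) (J : {set 'I_k}) x :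
  subhull U J x <-> exists a : 'rV[R]_k,
    [/\ supported J a, forall j, 0 <= a 0 j, \sum_j a 0 j = 1 & x = a *m U].
Proof.
have sumS (a : 'rV[R]_#|J|) :
    \sum_j (a *m rowsub (enum_val : 'I_#|J| -> 'I_k) 1%:M) 0 j = \sum_i a 0 i.
  under eq_bigr do rewrite mxE.
  rewrite exchange_big /=; apply: eq_bigr => i _; rewrite (bigD1 (enum_val i)) //= !mxE eqxx.
  by rewrite mulr1 big1 ?addr0 // => j ji; rewrite !mxE eq_sym (negbTE ji) mulr0.
split=> [[a [a0 a1 ->]]|[a [sa a0 a1 ->]]].
  exists (a *m rowsub enum_val 1%:M); split.
  - exact: rowsub1_supported.
  - move=> j; rewrite mxE sumr_ge0 // => i _; rewrite !mxE mulr_ge0 ?ler0n //.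
  - by rewrite sumS.
  - by rewrite -mulmxA -rowsubE.
exists (colsub enum_val a); split.
- by move=> j; rewrite mxE.
- by rewrite -sumS colsubK.
- by rewrite [in RHS]rowsubE mulmxA colsubK.
Qed.

Lemma face_sub (R : realType) (n : nat) (P Q : set 'rV[R]_n) : face P Q -> Q `<=` P.
Proof. by move=> [_ [c ->]] x []. Qed.

(** At a point of the face, the mean of the values of the functional at the generators attains their
    maximum, so only generators on the face carry weight. Faces are thus encoded by sets of
    generators, whence their finiteness and their lattice vertices. *)
Lemma face_subhull (R : realType) (k n : nat) (U : 'M[R]_(k, n)) Q :
  face (hull U) Q -> Q = subhull U (vertices_in U Q) /\ (0 < #|vertices_in U Q|)%N.
Proof.
move=> [[y Qy] [c QE]].
have QM x : Q x -> dot x c = dot y c.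
  by move: Qy; rewrite QE => -[Py my] [Px mx]; apply/eqP; rewrite eq_le my // mx.
have EQ : Q = subhull U (vertices_in U Q).
  apply/seteqP; split=> x.
    move=> Qx; apply/subhullP; have [a [a0 a1 xa]] : hull U x by move: Qx; rewrite QE => -[].
    exists a; split=> // j jQ; apply/eqP; apply: contraNT jQ => aj.
    have {}aj : 0 < a 0 j by rewrite lt_neqAle eq_sym aj a0.
    rewrite inE; apply/asboolP; rewrite QE; split=> [|z Pz]; first exact: hull_row.
    rewrite (@convex_sum_max R k a (fun j => dot (row j U) c) (dot x c)) //.
    - by move: Qx; rewrite QE => -[_]; apply.
    - by move=> i; move: Qx; rewrite QE => -[_]; apply; apply: hull_row.
    - by rewrite {1}xa dot_mulmx.
  move/subhullP => [a [sa a0 a1 xa]]; rewrite QE; split; first by exists a.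
  move=> z Pz; have -> : dot x c = dot y c.
    rewrite xa dot_mulmx; transitivity (\sum_j a 0 j * dot y c).
      apply: eq_bigr => j _; have [|/sa ->] := boolP (j \in vertices_in U Q).
        by rewrite inE => /asboolP /QM ->.
      by rewrite !mul0r.
    by rewrite -mulr_suml a1 mul1r.
  by move: Qy; rewrite QE => -[_]; apply.
split=> //; rewrite lt0n; apply/negP => /eqP J0.
move: Qy; rewrite EQ => /subhullP[a [sa _ a1 _]]; move: a1; rewrite big1 => [/eqP|j _].
  by rewrite eq_sym oner_eq0.
by apply: sa; rewrite (cards0_eq J0) inE.
Qed.

Lemma finite_faces (R : realType) (k n : nat) (U : 'M[R]_(k, n)) : finite_set (faces (hull U)).
Proof.
apply: (@sub_finite_set _ _ ((subhull U) @` setT)).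
  by move=> Q /face_subhull[-> _]; exists (vertices_in U Q).
by apply: finite_image; apply: finite_finset.
Qed.

(** All generators have positive weight at a relative interior point, so a functional that is
    maximal there is maximal at every generator. *)
Lemma relint_face_sub (R : realType) (k n : nat) (U : 'M[R]_(k, n)) (P Q : set 'rV[R]_n) x :
  (0 < k)%N -> hull U `<=` P -> relint (hull U) x -> face P Q -> Q x -> hull U `<=` Q.
Proof.
move=> k0 UP /(relint_hull _ _ k0)[a [a0 a1 xa]] [_ [c QE]] Qx.
have [Px mx] : P x /\ forall z, P z -> dot z c <= dot x c by move: Qx; rewrite QE.
have rowM j : dot (row j U) c = dot x c.
  apply: (@convex_sum_max R k a (fun j => dot (row j U) c) (dot x c)) => //.
  - by move=> i; rewrite ltW.
  - by move=> i; apply: mx; apply: UP; apply: hull_row.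
  - by rewrite {1}xa dot_mulmx.
move=> y Uy; rewrite QE; split; first exact: UP.
move=> z Pz; have [b [_ b1 ->]] := Uy; rewrite dot_mulmx.
under eq_bigr do rewrite rowM.
by rewrite -mulr_suml b1 mul1r; apply: mx.
Qed.

Definition barycentric (R : realType) (k n : nat) (U : 'M[R]_(k, n)) (x : 'rV[R]_n) (a : 'rV_k) :=
  [/\ forall j, 0 <= a 0 j, \sum_j a 0 j = 1 & x = a *m U].

(** For each j choose a representation positive at j if there is one; the average of these has the
    largest possible support. *)
Lemma maximal_support (R : realType) (k n : nat) (U : 'M[R]_(k, n)) x :
  hull U x -> exists2 b, barycentric U x b &
    forall a, barycentric U x a -> forall j, 0 < a 0 j -> 0 < b 0 j.
Proof.
move=> [a0 xa0].
have /choice[A hA] : forall j, exists a, barycentric U x a /\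
    forall a', barycentric U x a' -> 0 < a' 0 j -> 0 < a 0 j.
  move=> j; have [[a [xa aj]]|H] := pselect (exists a, barycentric U x a /\ 0 < a 0 j).
    by exists a.
  by exists a0; split=> // a' xa' aj; case: H; exists a'.
have k0 : (0 < k)%N.
  case: k U a0 xa0 A hA => // U a0 [_ + _].
  by rewrite big_ord0 => /eqP; rewrite eq_sym oner_eq0.
have kR : 0 < k%:R :> R by rewrite ltr0n.
pose u : 'rV[R]_k := const_mx k%:R^-1.
have u1 : \sum_j u 0 j = 1 by apply: sum_uniform_weights.
exists (u *m \matrix_j A j); first split.
- move=> j; rewrite mxE sumr_ge0 // => i _; rewrite !mxE mulr_ge0 ?invr_ge0 ?(ltW kR) //.
  by have [[H _ _] _] := hA i.
- apply: sum_mulmx_weights => // i; have [[_ H _] _] := hA i; rewrite -H.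
  by apply: eq_bigr => j _; rewrite mxE.
- rewrite -mulmxA mulmx_sum_row; transitivity (\sum_j u 0 j *: x).
    by rewrite -scaler_suml u1 scale1r.
  by apply: eq_bigr => j _; rewrite row_mul rowK; have [[_ _ <-] _] := hA j.
move=> a xa j aj; rewrite mxE (bigD1 j) //= ltr_pwDl //.
  by rewrite !mxE mulr_gt0 ?invr_gt0 //; apply: (hA j).2 xa aj.
rewrite sumr_ge0 // => i _; rewrite !mxE mulr_ge0 ?invr_ge0 ?(ltW kR) //.
by have [[H _ _] _] := hA i.
Qed.

(* [x] is a positive combination of the vertices in a maximal support [J]. By
   Farkas' lemma every vertex outside [J] is cut off by a hyperplane supporting
   the polytope at [x], and the sum of these functionals defines the face. *)
Lemma relint_face_exists (R : realType) (k n : nat) (U : 'M[R]_(k, n)) x :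
  hull U x -> exists2 Q, face (hull U) Q & relint Q x.
Proof.
move=> Ux; have [b xb bmax] := maximal_support Ux.
have [b0 b1 xbU] := xb.
pose w := homogenize U; pose X := row_mx x 1%:M : 'rV[R]_(n + 1).
have XE : X = b *m w by apply/homogenize_mul.
have /choice[C hC] : forall j, exists c : 'cV[R]_(n + 1),
    [/\ forall i, (w *m c) i 0 <= 0, (X *m c) 0 0 = 0 &
      b 0 j = 0 -> (w *m c) j 0 < 0].
  move=> j; have [bj|bj] := eqVneq (b 0 j) 0; last first.
    exists 0; split => [i||/eqP]; rewrite ?mulmx0 ?mxE //.
    by rewrite (negbTE bj).
  (* Having [- X] among the generators forces [c] to vanish at X. In the other alternative a
     positive multiple of X would be a combination with positive weight at j, against the maximality
     of [b]. *)
  have [[a a0 aE]|[c wc wjc]] := farkas (col_mx w (- X)) (- row j w).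
    exfalso; move: aE a0; rewrite -(hsubmxK a) mul_row_col mulmxN.
    move: (lsubmx a) (rsubmx a) => a1 a2 aE a0.
    have tX : a2 0 0 *: X = (a1 + delta_mx 0 j) *m w.
      rewrite mulmxDl -rowE -[row j w]opprK aE opprD opprK addrA subrr add0r.
      by rewrite [a2 in RHS]mx11_scalar mul_scalar_mx.
    have a1_ge0 i : 0 <= a1 0 i by have := a0 (lshift 1 i); rewrite row_mxEl.
    have [tx ta] : a2 0 0 *: x = (a1 + delta_mx 0 j) *m U /\
        \sum_i (a1 + delta_mx 0 j) 0 i = a2 0 0.
      apply/homogenize_mul; rewrite -tX /X scale_row_mx; congr row_mx.
      by rewrite scale_scalar_mx mulr1.
    have t0 : 0 < a2 0 0.
      rewrite -ta (bigD1 j) //= ltr_pwDl //.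
        by rewrite !mxE !eqxx ltr_wpDl.
      by rewrite sumr_ge0 // => i _; rewrite !mxE addr_ge0 ?ler0n.
    suff : 0 < b 0 j by rewrite bj ltxx.
    apply: (bmax ((a2 0 0)^-1 *: (a1 + delta_mx 0 j))).
      split.
      - by move=> i; rewrite !mxE mulr_ge0 ?invr_ge0 ?(ltW t0) // addr_ge0 ?ler0n.
      - by under eq_bigr do rewrite mxE; rewrite -mulr_sumr ta mulVf ?gt_eqF.
      - by rewrite -scalemxAl -tx scalerA mulVf ?gt_eqF // scale1r.
    by rewrite !mxE !eqxx mulr_gt0 ?invr_gt0 // ltr_wpDl.
  have wc0 i : (w *m c) i 0 <= 0 by have := wc (lshift 1 i); rewrite mul_col_mx col_mxEu.
  exists c; split=> //.
    apply/eqP; rewrite eq_le; apply/andP; split.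
      rewrite XE mulmx_entry -oppr_ge0 -sumrN sumr_ge0 // => i _.
      by rewrite -mulrN mulr_ge0 // oppr_ge0.
    by have := wc (rshift k 0); rewrite mul_col_mx col_mxEd mulNmx mxE oppr_le0.
  by move=> _; move: wjc; rewrite mulNmx mxE oppr_gt0 -row_mul mxE.
pose c := \sum_j C j.
have wcE i : (w *m c) i 0 = \sum_j (w *m C j) i 0 by rewrite mulmx_sumr summxE.
have wc i : (w *m c) i 0 <= 0.
  by rewrite wcE -oppr_ge0 -sumrN sumr_ge0 // => j _; rewrite oppr_ge0; have [] := hC j.
have Xc : (X *m c) 0 0 = 0.
  by rewrite mulmx_sumr summxE big1 // => j _; have [] := hC j.
have wc_lt j : b 0 j = 0 -> (w *m c) j 0 < 0.
  move=> bj; rewrite wcE (bigD1 j) //= ltr_wnDr //.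
    by rewrite -oppr_ge0 -sumrN sumr_ge0 // => i _; rewrite oppr_ge0; have [] := hC i.
  by have [_ _] := hC j; apply.
pose c1 := (usubmx c)^T; pose c0 := (dsubmx c) 0 0.
have dotE y : (row_mx y 1%:M *m c) 0 0 = dot y c1 + c0.
  rewrite -(vsubmxK c) mul_row_col mul1mx mxE; congr (_ + _).
  by rewrite mxE /dot; apply: eq_bigr => i _; rewrite [X in _ = _ * X]mxE.
have rowE' j : dot (row j U) c1 + c0 = (w *m c) j 0.
  rewrite -dotE; have -> : row_mx (row j U) 1%:M = row j w.
    rewrite row_row_mx; congr row_mx; apply/matrixP => s t.
    by rewrite !ord1 !mxE.
  by rewrite -row_mul mxE.
have dot_le y : hull U y -> dot y c1 <= dot x c1.
  move=> [a [a0 a1 ya]]; rewrite -(lerD2r c0) -[leRHS]dotE Xc -dotE.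
  have -> : row_mx y 1%:M = a *m w by apply/homogenize_mul.
  rewrite mulmx_entry -oppr_ge0 -sumrN sumr_ge0 // => i _.
  by rewrite -mulrN mulr_ge0 // oppr_ge0.
pose Q := [set y | hull U y /\ forall z, hull U z -> dot z c1 <= dot y c1].
have Qx : Q x by [].
have fQ : face (hull U) Q by split; [exists x | exists c1].
exists Q => //; have [EQ cQ] := face_subhull fQ; rewrite EQ; apply/relint_hull => //.
have VQ j : (j \in vertices_in U Q) = (0 < b 0 j).
  rewrite inE; apply/asboolP/idP => [[_ Qj]|bj].
    rewrite lt_neqAle eq_sym b0 andbT; apply/eqP => /wc_lt.
    rewrite -rowE' ltNge => /negP; apply.
    by rewrite -Xc dotE lerD2r; apply: Qj.
  split=> [|z Uz]; first exact: hull_row.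
  rewrite (@convex_sum_max R k b (fun j => dot (row j U) c1) (dot x c1)) //.
  - exact: dot_le.
  - by move=> i; apply/dot_le/hull_row.
  - by rewrite {1}xbU dot_mulmx.
have sb : supported (vertices_in U Q) b.
  by move=> j; rewrite VQ lt_neqAle b0 andbT negbK => /eqP.
exists (colsub enum_val b); split.
- by move=> j; rewrite mxE -VQ enum_valP.
- transitivity (\sum_(j in vertices_in U Q) b 0 j).
    by rewrite [RHS]big_enum_val; apply: eq_bigr => j _; rewrite mxE.
  by rewrite -[RHS]b1 [RHS](bigID (mem (vertices_in U Q))) /= [X in _ + X]big1 ?addr0 // => j /sb.
- by rewrite rowsubE mulmxA colsubK.
Qed.

(** The face through a point of [E] is taken in the whole polytope; by [relint_face_sub] it lies in
    [E], and the same functional exhibits it as a face of [E]. Two faces whose relative interiors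
    meet contain each other. *)
Lemma dilate_face_partition (R : realType) (k n l : nat) (U : 'M[R]_(k, n)) E : (0 < l)%N ->
  face (hull U) E ->
  (forall x, dilate l E x <->
     exists2 Q, face (hull U) Q /\ face E Q & relint (dilate l Q) x) /\
  (forall Q Q' x, face (hull U) Q -> face (hull U) Q' ->
     relint (dilate l Q) x -> relint (dilate l Q') x -> Q = Q').
Proof.
move=> l0 fE; have l0R : l%:R != 0 :> R by rewrite pnatr_eq0 -lt0n.
have relE Q x : face (hull U) Q -> relint (dilate l Q) x <-> relint Q (l%:R^-1 *: x).
  by move=> /face_subhull[EQ cQ]; rewrite EQ; apply: relint_dilate.
have sub Q Q' x : face (hull U) Q -> face (hull U) Q' -> relint Q x -> Q' x -> Q `<=` Q'.
  move=> fQ fQ'; have sQ := face_sub fQ; have [EQ cQ] := face_subhull fQ.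
  move: sQ; rewrite EQ => sQ rx Qx; exact: relint_face_sub cQ sQ rx fQ' Qx.
split.
  move=> x; split=> [[y Ey <-]|[Q [fQ EQ] [[y Qy <-] _]]]; last first.
    by exists y => //; apply: face_sub EQ _ Qy.
  have [Q fQ rQ] := relint_face_exists (face_sub fE Ey).
  have QE := sub _ _ _ fQ fE rQ Ey.
  exists Q; last by apply/relE => //; rewrite scalerA mulVf // scale1r.
  split=> //; have [Q0 [c cQ]] := fQ; split=> //; exists c.
  have Qy : Q y by case: rQ.
  apply/seteqP; split=> z.
    by move=> Qz; split; [apply: QE | move: Qz; rewrite cQ => -[_ H] t /(face_sub fE) /H].
  move=> [Ez mz]; rewrite cQ; split; first exact: face_sub fE _ Ez.
  move=> t Ut; apply: le_trans (mz _ Ey).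
  by move: Qy; rewrite cQ => -[_]; apply.
move=> Q Q' x fQ fQ' /(relE _ _ fQ) rQ /(relE _ _ fQ') rQ'.
apply/seteqP; split; first by apply: sub fQ fQ' rQ _; case: rQ'.
by apply: sub fQ' fQ rQ' _; case: rQ.
Qed.

Lemma lattice_polytope_hull (R : realType) (n : nat) (P : set 'rV[R]_n) :
  lattice_polytope P ->
  exists k (U : 'M[int]_(k, n)), (0 < k)%N /\ P = hull (map_mx intr U).
Proof.
move=> [V [/finite_seqP[s ->] [m0 /= ms] ->]].
exists (size s), (\matrix_(i < size s) nth m0 s i); split; first by case: s ms.
rewrite -conv_hull_rows; congr conv_hull; apply/seteqP; split=> x.
  move=> [m /= sm <-]; have im : (index m s < size s)%N by rewrite index_mem.
  exists (Ordinal im) => //; apply/rowP => j; rewrite !mxE /=.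
  by rewrite nth_index.
move=> [i _ <-]; exists (nth m0 s i); first exact: mem_nth.
by apply/rowP => j; rewrite !mxE.
Qed.

Lemma homog_mevalN (F : numFieldType) (n : nat) (phi : {mpoly F[n]}) v :
  phi \is homog mdeg ->
  phi.@[fun i => - v i] = (-1) ^+ (msize phi).-1 * phi.@[v].
Proof.
move=> /dhomogP hphi; rewrite !mevalE mulr_sumr; apply: eq_big_seq => m /hphi dm.
have {}dm : mdeg m = (msize phi).-1 := dm.
rewrite mulrCA; congr (_ * _); rewrite -dm mdegE expr_sum -big_split /=.
by apply: eq_bigr => i _; exact: exprNn.
Qed.

Theorem face_reciprocity (R : realType) (n : nat) (P Q : set 'rV[R]_n)
    (phi : {mpoly R[i][n]}) :
  lattice_polytope P -> face P Q -> phi \is homog mdeg ->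
  exists p : {poly R[i]}, forall l : nat, (0 < l)%N ->
    lattice_sum phi (relint (dilate l Q)) = p.[l%:R]
    /\ \sum_(E \in [set E | face P E /\ face Q E]) lattice_sum phi (relint (dilate l E))
       = (-1) ^+ (aff_dim Q + tdeg phi) * p.[- l%:R].
Proof.
move=> /lattice_polytope_hull[k [U [k0 ->]]] fQ hphi.
have [r [W [cQ EQ]]] : exists r (W : 'M[int]_(r, n)), (0 < r)%N /\ Q = hull (map_mx intr W).
  have [EQ cQ] := face_subhull fQ; exists #|vertices_in (map_mx intr U) Q|.
  exists (rowsub enum_val U); split=> //.
  by rewrite {1}EQ; congr hull; apply/matrixP => i j; rewrite !mxE.
have [fin [p hp]] := cone_reciprocity R W cQ (fun v => homog_mevalN v hphi).
exists p => l l0; have [E1 E2] := hp l l0.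
split.
  rewrite -E1; apply: eq_fsbigl; apply/seteqP; split=> m /=;
    by rewrite EQ relint_dilate_cone // map_homogenize.
rewrite [aff_dim _](_ : _ = (\rank (homogenize (map_mx (intr : int -> R) W))).-1);
  last by rewrite EQ aff_dim_hull.
rewrite -map_homogenize -E2.
have [part disj] := dilate_face_partition l0 fQ.
have SE m : cone (map_mx (intr : int -> R) (homogenize W)) (row_mx (map_mx intr m) l%:R%:M) <->
    dilate l Q (lattice_pt R m).
  by rewrite map_homogenize EQ; apply: iff_sym; apply: dilate_hull_cone.
rewrite (fsum_partition (D := [set E | face (hull (map_mx intr U)) E /\ face Q E])
  (A := fun E => [set m | relint (dilate l E) (lattice_pt R m)])) //.
- by apply: sub_finite_set (finite_faces (map_mx intr U)) => E [].
- by move=> m /=; rewrite SE; apply: part.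
- by move=> E E' m [fE _] [fE' _]; apply: disj.
Qed.

(** * The substitution of 1/y for y, and Laurent polynomials *)

Section Inversion.
Variable F : fieldType.
Local Notation y := (yvar F).
Implicit Types (p q : {poly F}) (g h : ratfun F).

Lemma yvar_neq0 : y != 0.
Proof. by rewrite tofrac_eq0 polyX_eq0. Qed.

Lemma rconst_is_zmod_morphism : zmod_morphism (@rconst F).
Proof. by move=> a b; rewrite /rconst !rmorphB. Qed.

Lemma rconst_is_monoid_morphism : monoid_morphism (@rconst F).
Proof. by split=> [|a b]; rewrite /rconst ?rmorph1 ?rmorphM. Qed.

HB.instance Definition _ := GRing.isZmodMorphism.Build F (ratfun F) (@rconst F)
  rconst_is_zmod_morphism.
HB.instance Definition _ := GRing.isMonoidMorphism.Build F (ratfun F) (@rconst F)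
  rconst_is_monoid_morphism.

Definition horner_invy p : ratfun F := (map_poly (@rconst F) p).[y^-1].

Lemma horner_invyD p q : horner_invy (p + q) = horner_invy p + horner_invy q.
Proof. by rewrite /horner_invy rmorphD hornerD. Qed.

Lemma horner_invyM p q : horner_invy (p * q) = horner_invy p * horner_invy q.
Proof. by rewrite /horner_invy rmorphM hornerM. Qed.

Lemma at_invy_frac p q : q != 0 -> at_invy (p%:F / q%:F) = horner_invy p / horner_invy q.
Proof. exact: at_invyE. Qed.

Lemma ratfun_frac g : exists p q, q != 0 /\ g = p%:F / q%:F.
Proof.
by exists \n_(repr g), \d_(repr g); split; [apply: denom_ratioP | apply: ratfun_repr].
Qed.

Lemma at_invy_poly p : at_invy p%:F = horner_invy p.
Proof.
have := at_invy_frac p (oner_neq0 _); rewrite rmorph1 divr1 => ->.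
by rewrite /horner_invy rmorph1 hornerC divr1.
Qed.

Lemma at_invyD g h : at_invy (g + h) = at_invy g + at_invy h.
Proof.
have [p [q [q0 ->]]] := ratfun_frac g; have [r [s [s0 ->]]] := ratfun_frac h.
rewrite addf_div ?tofrac_eq0 // -!rmorphM -rmorphD /= !at_invy_frac ?mulf_neq0 //.
by rewrite addf_div ?horner_invy_neq0 // !(horner_invyD, horner_invyM).
Qed.

Lemma at_invyM g h : at_invy (g * h) = at_invy g * at_invy h.
Proof.
have [p [q [q0 ->]]] := ratfun_frac g; have [r [s [s0 ->]]] := ratfun_frac h.
rewrite mulf_div -!rmorphM /= !at_invy_frac ?mulf_neq0 //.
by rewrite mulf_div !horner_invyM.
Qed.

Lemma at_invy_const (c : F) : at_invy (rconst c) = rconst c.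
Proof. by rewrite at_invy_poly /horner_invy map_polyC hornerC. Qed.

Lemma at_invy_is_zmod_morphism : zmod_morphism (@at_invy F).
Proof.
move=> g h; rewrite at_invyD -[- h]mulN1r at_invyM.
by rewrite -[-1]/(- (1 : ratfun F)) -(rmorph1 (@rconst F)) -rmorphN
  at_invy_const rmorphN rmorph1 mulN1r.
Qed.

Lemma at_invy_is_monoid_morphism : monoid_morphism (@at_invy F).
Proof.
by split; [rewrite -(rmorph1 (@rconst F)) at_invy_const | apply: at_invyM].
Qed.

HB.instance Definition _ := GRing.isZmodMorphism.Build (ratfun F) (ratfun F) (@at_invy F)
  at_invy_is_zmod_morphism.
HB.instance Definition _ := GRing.isMonoidMorphism.Build (ratfun F) (ratfun F) (@at_invy F)
  at_invy_is_monoid_morphism.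

Lemma at_invy_yvar : at_invy y = y^-1.
Proof. by rewrite at_invy_poly /horner_invy map_polyX hornerX. Qed.

Lemma horner_rconst p : (map_poly (@rconst F) p).[y] = p%:F.
Proof.
rewrite -[in RHS](coefK p) poly_def rmorph_sum horner_coef size_map_poly.
by apply: eq_bigr => i _; rewrite coef_map -mul_polyC rmorphM rmorphXn.
Qed.

Lemma at_invyK : involutive (@at_invy F).
Proof.
move=> g; have [p [q [q0 ->]]] := ratfun_frac g.
rewrite at_invy_frac // fmorph_div /horner_invy -!horner_map /=.
rewrite fmorphV /= at_invy_yvar invrK -!map_poly_comp.
by rewrite !(eq_map_poly at_invy_const) !horner_rconst.
Qed.

(** [interpolates] asks for Laurent coefficients, so a polynomial can be identified with [ipoly]
    only after its coefficients are shown to be Laurent. *)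
Definition is_laurent g : Prop := laurent setT g.

Lemma laurentP g : is_laurent g <-> exists p k, g = p%:F / y ^+ k.
Proof. by split=> [[p [k [_ ->]]]|[p [k ->]]]; exists p, k. Qed.

Lemma laurent_poly p : is_laurent p%:F.
Proof. by apply/laurentP; exists p, 0%N; rewrite expr0 divr1. Qed.

Lemma laurentV : is_laurent y^-1.
Proof. by apply/laurentP; exists 1, 1%N; rewrite rmorph1 expr1 div1r. Qed.

Lemma laurentD g h : is_laurent g -> is_laurent h -> is_laurent (g + h).
Proof.
move=> /laurentP[p [k ->]] /laurentP[q [l ->]]; apply/laurentP.
exists (p * 'X^l + q * 'X^k), (k + l)%N.
by rewrite addf_div ?expf_neq0 ?yvar_neq0 // rmorphD !rmorphM !rmorphXn exprD.
Qed.

Lemma laurentM g h : is_laurent g -> is_laurent h -> is_laurent (g * h).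
Proof.
move=> /laurentP[p [k ->]] /laurentP[q [l ->]]; apply/laurentP.
by exists (p * q), (k + l)%N; rewrite mulf_div rmorphM exprD.
Qed.

Lemma laurentX g k : is_laurent g -> is_laurent (g ^+ k).
Proof.
move=> lg; elim: k => [|k IH]; last by rewrite exprS; apply: laurentM.
by rewrite expr0 -(rmorph1 (@tofrac _)); apply: laurent_poly.
Qed.

Lemma laurent_sum (I : Type) (s : seq I) (P : pred I) (G : I -> ratfun F) :
  (forall i, P i -> is_laurent (G i)) -> is_laurent (\sum_(i <- s | P i) G i).
Proof.
move=> H; elim/big_ind: _ => //; last exact: laurentD.
by rewrite -(rmorph0 (@tofrac _)); apply: laurent_poly.
Qed.

Lemma laurent_sum_seq (I : eqType) (s : seq I) (P : pred I) (G : I -> ratfun F) :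
  (forall i, i \in s -> is_laurent (G i)) -> is_laurent (\sum_(i <- s | P i) G i).
Proof. by move=> H; rewrite big_seq_cond; apply: laurent_sum => i /andP[/H]. Qed.

Lemma laurent_1yX k : is_laurent ((1 + y) ^+ k).
Proof.
by apply: laurentX; rewrite -(rmorph1 (@tofrac _)) -rmorphD; apply: laurent_poly.
Qed.

Lemma laurent_at_invy g : is_laurent g -> is_laurent (at_invy g).
Proof.
move=> /laurentP[p [k ->]]; rewrite fmorph_div rmorphXn /= at_invy_yvar at_invy_poly.
rewrite exprVn invrK; apply: laurentM; last by rewrite -rmorphXn; apply: laurent_poly.
rewrite /horner_invy horner_coef; apply: laurent_sum => i _.
by rewrite coef_map; apply: laurentM; [apply: laurent_poly | apply/laurentX/laurentV].
Qed.

End Inversion.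

Lemma ratfun_natr_inj (F : numFieldType) : injective (fun l : nat => l%:R : ratfun F).
Proof.
move=> a b /= /eqP; rewrite -!(rmorph_nat (@rconst F)) (inj_eq (fmorph_inj _)).
by rewrite eqr_nat => /eqP.
Qed.

Lemma ratfun_poly_eq (F : numFieldType) (p q : {poly ratfun F}) :
  (forall l : nat, (0 < l)%N -> p.[l%:R] = q.[l%:R]) -> p = q.
Proof.
move=> pq; apply/eqP; rewrite -subr_eq0; apply: contraT => d0.
pose s := [seq l.+1%:R : ratfun F | l <- iota 0 (size (p - q))].
have: (size s < size (p - q)%R)%N.
  apply: max_poly_roots => //.
    by apply/allP => _ /mapP[l _ ->]; rewrite /root hornerD hornerN pq // subrr.
  by rewrite map_inj_uniq ?iota_uniq // => i j /ratfun_natr_inj[].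
by rewrite size_map size_iota ltnn.
Qed.

(** * Reciprocity for weighted Ehrhart polynomials *)

(* The field operations of [ratfun F] are expensive to unify; hence the abstract
   field [K] with its involution [iota]. *)
Lemma dual_sum_exchange (K : fieldType) (iota : {rmorphism K -> K}) (y : K) (T : eqType)
    (s : seq T) (C : rel T) (d : T -> nat) (e : nat) (g I : T -> K) :
  y != 0 -> iota y = y^-1 -> involutive iota ->
  (forall E, iota (I E) = I E) ->
  (forall Q E, C Q E -> (d E <= d Q)%N) ->
  \sum_(Q <- s) g Q * (1 + y) ^+ d Q * ((-1) ^+ (d Q + e) * \sum_(E <- s | C Q E) I E)
  = (-1) ^+ e * iota (\sum_(Q <- s)
      (\sum_(E <- s | C E Q) (1 + y) ^+ (d E - d Q) * (- y) ^- d E * iota (g E))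
      * (1 + y) ^+ d Q * I Q).
Proof.
move=> y0 iy iK iI dC.
have term Q E : C E Q ->
    iota ((1 + y) ^+ (d E - d Q) * (- y) ^- d E * iota (g E) * (1 + y) ^+ d Q * I Q)
    = g E * (-1) ^+ d E * (1 + y) ^+ d E * I Q.
  move=> CEQ; rewrite !rmorphM iK iI fmorphV !rmorphXn rmorphN rmorphD rmorph1 iy.
  rewrite -invrN exprVn invrK.
  transitivity (g E * ((1 + y^-1) ^+ (d E - d Q) * (1 + y^-1) ^+ d Q) * (- y) ^+ d E * I Q).
    by ring.
  rewrite -exprD subnK ?dC // -!mulrA; congr (_ * _); rewrite !mulrA -!exprMn.
  congr (_ ^+ _ * _); by rewrite mulrN mulrDl mul1r mulVf // mulN1r addrC.
rewrite rmorph_sum mulr_sumr.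
under eq_bigr do rewrite !mulr_sumr.
rewrite (exchange_big_dep xpredT) //=; apply: eq_bigr => Q _.
rewrite !mulr_suml rmorph_sum mulr_sumr; apply: eq_bigr => E CEQ.
by rewrite term // exprD; ring.
Qed.

Section EhrhartPolynomial.
Variables (F : numFieldType) (T : eqType) (s : seq T) (C : rel T) (d : T -> nat) (e : nat).
Variable p : T -> {poly F}.
Local Notation y := (yvar F).
Implicit Types g : T -> ratfun F.

(** Here [s] stands for the list of faces, [C Q E] for E being a face of Q, [d] for the dimension
    and [p Q] for the polynomial of the lattice sums over the relative interiors of the dilates of
    Q. *)
Definition ehrhart_poly g : {poly ratfun F} :=
  \sum_(Q <- s) (g Q * (1 + y) ^+ d Q) *: map_poly (@rconst F) (p Q).

Definition dual g Q : ratfun F :=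
  \sum_(E <- s | C E Q) (1 + y) ^+ (d E - d Q) * (- y) ^- d E * at_invy (g E).

Lemma horner_ehrhart_poly g (z : int) :
  (ehrhart_poly g).[z%:~R] = \sum_(Q <- s) g Q * (1 + y) ^+ d Q * rconst (p Q).[z%:~R].
Proof.
rewrite horner_sum; apply: eq_bigr => Q _.
by rewrite hornerZ -(rmorph_int (@rconst F)) horner_map.
Qed.

Lemma laurent_ehrhart_poly g i :
  (forall Q, Q \in s -> is_laurent (g Q)) -> is_laurent (ehrhart_poly g)`_i.
Proof.
move=> lg; rewrite coef_sum; apply: laurent_sum_seq => Q Qs.
rewrite coefZ coef_map; apply: laurentM; last exact: laurent_poly.
by apply: laurentM; [apply: lg | apply: laurent_1yX].
Qed.

Lemma laurent_dual g Q : (forall E, E \in s -> is_laurent (g E)) -> is_laurent (dual g Q).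
Proof.
move=> lg; apply: laurent_sum_seq => E Es.
apply: laurentM; last by apply/laurent_at_invy/lg.
apply: laurentM; first exact: laurent_1yX.
rewrite -exprVn; apply: laurentX; rewrite invrN -mulN1r.
by apply: laurentM (laurentV _); rewrite -(rmorphN1 (@tofrac _)); apply: laurent_poly.
Qed.

Hypothesis dC : forall Q E, C Q E -> (d E <= d Q)%N.
Hypothesis hp : forall Q, Q \in s -> forall l, (0 < l)%N ->
  \sum_(E <- s | C Q E) (p E).[l%:R] = (-1) ^+ (d Q + e) * (p Q).[- l%:R].

(** An identity of polynomials in l, so it is enough to check it at positive l, where [hp] applies;
    evaluation at any integer commutes with [at_invy], which fixes constants. *)
Lemma ehrhart_poly_opp g (z : int) :
  (ehrhart_poly g).[(- z)%:~R] = (-1) ^+ e * at_invy (ehrhart_poly (dual g)).[z%:~R].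
Proof.
suff E : ehrhart_poly g \Po (- 'X) = (-1) ^+ e *: map_poly (@at_invy F) (ehrhart_poly (dual g)).
  have := congr1 (horner^~ z%:~R) E.
  rewrite horner_comp hornerN hornerX hornerZ rmorphN => ->.
  by rewrite -[in LHS](rmorph_int (@at_invy F)) horner_map.
apply: ratfun_poly_eq => l l0.
rewrite horner_comp hornerN hornerX hornerZ -[in RHS](rmorph_nat (@at_invy F)) horner_map.
rewrite !pmulrn -rmorphN !horner_ehrhart_poly.
have := @dual_sum_exchange _ (@at_invy F) y T s C d e g (fun Q => rconst (p Q).[l%:R])
  (yvar_neq0 F) (at_invy_yvar F) (@at_invyK F) (fun E => at_invy_const _) dC.
rewrite -pmulrn => <-; apply: eq_big_seq => Q Qs; congr (_ * _).
rewrite -(rmorph_sum (@rconst F)) hp // rmorphM rmorph_sign mulrA -expr2 sqrr_sign mul1r.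
by rewrite rmorphN.
Qed.

(** Inversion turns the factor (1 + y)^e into (1 + 1/y)^e = y^(-e) (1 + y)^e, which is why (-y)^e
    replaces (-1)^e. *)
Lemma ehrhart_poly_opp_scaled g (z : int) :
  (1 + y) ^+ e * (ehrhart_poly g).[(- z)%:~R] =
  (- y) ^+ e * at_invy ((1 + y) ^+ e * (ehrhart_poly (dual g)).[z%:~R]).
Proof.
rewrite ehrhart_poly_opp at_invyM; move: (at_invy (ehrhart_poly _).[_]) => u.
rewrite rmorphXn rmorphD rmorph1 /= at_invy_yvar !mulrA -!exprMn.
congr (_ ^+ _ * _).
by rewrite mulNr mulrDr mulr1 divff ?yvar_neq0 // mulrN1 addrC.
Qed.

End EhrhartPolynomial.

Section FaceSums.
Variables (R : realType) (n : nat) (P : set 'rV[R]_n).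
Hypothesis hP : lattice_polytope P.

Lemma finite_faces_lattice : finite_set (faces P).
Proof. by have [k [U [_ ->]]] := lattice_polytope_hull hP; apply: finite_faces. Qed.

Definition face_seq : seq (set 'rV[R]_n) := fset_set (faces P).

Definition face_rel : rel (set 'rV[R]_n) := fun Q E => `[< face Q E >].

Lemma face_seqP Q : Q \in face_seq <-> face P Q.
Proof.
rewrite /face_seq in_fset_set; last exact: finite_faces_lattice.
by rewrite in_setE.
Qed.

Lemma sum_faces (V : nmodType) (G : set 'rV[R]_n -> V) :
  \sum_(Q \in faces P) G Q = \sum_(Q <- face_seq) G Q.
Proof. by rewrite fsbig_finite //; apply: finite_faces_lattice. Qed.

Lemma sum_faces_cond (V : nmodType) (C : set 'rV[R]_n -> Prop) (G : set 'rV[R]_n -> V) :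
  \sum_(Q \in [set Q | face P Q /\ C Q]) G Q = \sum_(Q <- face_seq | `[< C Q >]) G Q.
Proof.
rewrite (_ : [set Q | _] = faces P `&` [set Q | C Q]) // fsbig_mkcondr sum_faces.
rewrite [RHS]big_mkcond; apply: eq_bigr => Q _.
have -> // : (Q \in [set Q | C Q]) = `[< C Q >].
by apply/idP/asboolP; rewrite in_setE.
Qed.

Lemma dual_weightE (g : set 'rV[R]_n -> ratfun R[i]) :
  dual_weight P g = dual face_seq face_rel (@aff_dim R n) g.
Proof.
by apply/funext => Q; rewrite /dual_weight (sum_faces_cond (fun E => face E Q)).
Qed.

Variables (phi : {mpoly R[i][n]}) (p : set 'rV[R]_n -> {poly R[i]}).
Hypothesis hp : forall Q, face P Q -> forall l, (0 < l)%N ->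
  lattice_sum phi (relint (dilate l Q)) = (p Q).[l%:R].

Local Notation ehr := (ehrhart_poly face_seq (@aff_dim R n) p).

Lemma Etilde_pos_poly g l : (0 < l)%N -> Etilde_pos P phi g l = (ehr g).[l%:R].
Proof.
move=> l0; rewrite [l%:R]pmulrn horner_ehrhart_poly /Etilde_pos sum_faces.
by apply: eq_big_seq => Q /face_seqP fQ; rewrite hp.
Qed.

Lemma EtildeE g z : (forall Q, Q \in face_seq -> is_laurent (g Q)) ->
  Etilde P phi g z = (ehr g).[z%:~R].
Proof.
move=> lg; rewrite /Etilde (@ipolyE _ _ (ehr g)) //; split=> [i|l l0].
  exact: laurent_ehrhart_poly.
by rewrite Etilde_pos_poly.
Qed.

Lemma EhrE g z : (forall Q, Q \in face_seq -> is_laurent (g Q)) ->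
  Ehr P phi g z = (1 + yvar R[i]) ^+ tdeg phi * (ehr g).[z%:~R].
Proof.
move=> lg; rewrite /Ehr (@ipolyE _ _ ((1 + yvar R[i]) ^+ tdeg phi *: ehr g)).
  exact: hornerZ.
split=> [i|l l0].
  rewrite coefZ; exact: laurentM (laurent_1yX _ _) (laurent_ehrhart_poly _ _ _ lg).
by rewrite hornerZ /E_pos Etilde_pos_poly.
Qed.

End FaceSums.

Lemma weight_laurent (R : realType) (n : nat) (P : set 'rV[R]_n) f Q :
  weight_function P f -> face P Q -> is_laurent (f Q).
Proof. by move=> hf /hf[p [k [_ ->]]]; apply/laurentP; exists p, k. Qed.

Unset Implicit Arguments.

Theorem theorem1p6 (R : realType) (n : nat) (P : set 'rV[R]_n)
    (phi : {mpoly R[i][n]}) (f : set 'rV[R]_n -> ratfun R[i])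
    (hP : lattice_polytope P) (hdim : aff_dim P = n)
    (hphi : phi \is homog mdeg) (hf : weight_function P f) :
  forall l : int,
    Ehr P phi f (- l)
      = (- yvar R[i]) ^+ tdeg phi * at_invy (Ehr P phi (dual_weight P f) l)
    /\
    Etilde P phi f (- l)
      = (-1) ^+ tdeg phi * at_invy (Etilde P phi (dual_weight P f) l).
Proof.
(* One polynomial for every face is chosen at once; sets that are not faces get the default 0. *)
have /choice[p hp] : forall Q, exists p : {poly R[i]}, face P Q -> forall l, (0 < l)%N ->
    lattice_sum phi (relint (dilate l Q)) = p.[l%:R]
    /\ \sum_(E \in [set E | face P E /\ face Q E]) lattice_sum phi (relint (dilate l E))
       = (-1) ^+ (aff_dim Q + tdeg phi) * p.[- l%:R].
  move=> Q; have [fQ|] := pselect (face P Q); last by exists 0.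
  by have [p hp] := face_reciprocity hP fQ hphi; exists p.
have hp1 Q : face P Q -> forall l, (0 < l)%N ->
    lattice_sum phi (relint (dilate l Q)) = (p Q).[l%:R].
  by move=> fQ l l0; have [] := hp Q fQ l l0.
have hp2 Q : Q \in face_seq P -> forall l, (0 < l)%N ->
    \sum_(E <- face_seq P | face_rel Q E) (p E).[l%:R]
    = (-1) ^+ (aff_dim Q + tdeg phi) * (p Q).[- l%:R].
  move=> /(face_seqP hP) fQ l l0; have [_ <-] := hp Q fQ l l0.
  rewrite (sum_faces_cond hP (fun E => face Q E)) big_seq_cond [RHS]big_seq_cond.
  by apply: eq_bigr => E /andP[/(face_seqP hP) fE _]; rewrite hp1.
have dimC (Q E : set 'rV[R]_n) : face_rel Q E -> (aff_dim E <= aff_dim Q)%N.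
  by move=> /asboolP /face_sub /aff_dim_sub.
have lf Q : Q \in face_seq P -> is_laurent (f Q).
  by move=> /(face_seqP hP); apply: weight_laurent.
have lDf Q : Q \in face_seq P -> is_laurent (dual_weight P f Q).
  by move=> _; rewrite (dual_weightE hP); apply: laurent_dual.
move=> l; rewrite !(EhrE hP hp1) // !(EtildeE hP hp1) // (dual_weightE hP).
by split; [apply: ehrhart_poly_opp_scaled | apply: ehrhart_poly_opp].
Qed.
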